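(* Let $S(v_1,\gamma_1),\dots,S(v_n,\gamma_n)$ be $n\ge2$ spheres in $\mathbb{R}^d$ with centers $v_i\in\mathbb{R}^d$ and radii $\gamma_i\ge0$, let $\gamma^*$ be the optimal value of $$\min_{u\in\mathbb{R}^d,\ \gamma\in\mathbb{R}}\ \gamma\quad\text{s.t.}\quad\|u-v_i\|_2\le\gamma-\gamma_i\quad\forall i\in\{1,\dots,n\},$$ and let $\varepsilon\in(0,1]$. The primal-dual meta-algorithm for this problem (described in the context), which computes an enclosing sphere of radius at most $(1+\varepsilon)\gamma^*$, can be parallelized in the work-span model, and the parallel algorithm requires $O\Big(\frac{nd\log n}{\varepsilon^2}\Big)$ work and has $O\Big(\frac{\log(nd)\log n}{\varepsilon^2}\Big)$ span.
   Context: Work-span model: a computation is a directed acyclic graph of elementary operations on real numbers (arithmetic, comparisons, square roots, exponentials); the work is the total number of operations and the span is the length of the longest path. Constants in $O(\cdot)$ are absolute. Second-order cone: $\mathcal{Q}^{d+1}=\{(u;u_0)\in\mathbb{R}^{d+1}:\|u\|_2\le u_0\}$. An element $(u;u_0)\in\mathbb{R}^{d+1}$ has spectral decomposition $\lambda_1q_1+\lambda_2q_2$ with $\lambda_{1,2}=\frac1{\sqrt2}(u_0\pm\|u\|_2)$, $q_{1,2}=\frac1{\sqrt2}(\pm v;1)$, where $v=u/\|u\|_2$ if $u\ne0$ and any unit vector otherwise. Its trace is $\sqrt2u_0$ and $\exp(u;u_0)=e^{\lambda_1}q_1+e^{\lambda_2}q_2$. In a product of such cones (denoted $\oplus$), exponentials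 are taken componentwise and traces are summed. The meta-algorithm for this problem. Let $D=\max_{i\ge2}(\|v_1-v_i\|_2+\gamma_1+\gamma_i)$; $\gamma^*\in[D/2,D]$. Feasibility test for a guess $\alpha$ and tolerance $\varepsilon'$: put $R=\sqrt2$, $\rho=3D/\sqrt2$, $r=2(n-1)$, $T=\lceil4R^2\rho^2\ln r/(\varepsilon'^2\alpha^2)\rceil$, $\eta=\sqrt{\ln r/T}$. Start with $p^{(1)}=e/r$, where $e=\oplus_{i=2}^n(0;\sqrt2)$. In iteration $t=1,\dots,T$, with $p^{(t)}=\oplus_{i=2}^n(w_i^{(t)};s_i^{(t)})\in\oplus_{i=2}^n\mathcal{Q}^{d+1}$ of trace one, solve (in closed form) $$\max_{u,\gamma}\Big(\sum_{i=2}^nw_i^{(t)}\Big)^Tu+\frac{\gamma}{\sqrt2}-\sum_{i=2}^nv_i^Tw_i^{(t)}-\sum_{i=2}^n\gamma_is_i^{(t)}\quad\text{s.t. }\gamma\le\alpha,\ \|u-v_1\|_2\le\gamma-\gamma_1 .$$ If it is infeasible or has negative value, conclude $\gamma^*>\alpha$ and terminate. Otherwise let $(u^{(t)},\gamma^{(t)})$ be an optimal solution (with $\gamma^{(t)}=\alpha$), let $\bar u^{(t)}$ be the average of $u^{(1)},\dots,u^{(t)}$, and set $p^{(t+1)}=\frac1C\exp\big(-\frac{\eta t}{\rho}\oplus_{i=2}^n(\bar u^{(t)}-v_i;\alpha-\gamma_i)\big)$, with $C$ normalizing the trace to one. If there is no termination within $T$ iterations, output the sphere with center $\bar u^{(T)}$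 and radius $(1+\varepsilon')\alpha$. Search over $\alpha$: start from $[L_0,U_0]=[D/2,D]$. In step $i\ge1$ run the feasibility test with $\alpha_i=L_{i-1}+\frac13(U_{i-1}-L_{i-1})$ and $\varepsilon_i=\frac{1}{3\alpha_i}(U_{i-1}-L_{i-1})$. If it concludes $\gamma^*>\alpha_i$, set $[L_i,U_i]=[\alpha_i,U_{i-1}]$; otherwise set $[L_i,U_i]=[L_{i-1},(1+\varepsilon_i)\alpha_i]$ and keep the sphere found. Continue until $U_i-L_i$ is at most the desired additive error $\varepsilon\gamma^*$. (Initially, the sphere centered at $v_1$ with radius $D$ is an enclosing sphere.) *)

(* Defs.v *)
From HB Require Import structures.
From mathcomp Require Import all_boot all_order all_algebra.
From mathcomp Require Import all_classical all_reals all_analysis.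

Set Implicit Arguments.
Unset Strict Implicit.
Unset Printing Implicit Defensive.

Import Order.TTheory GRing.Theory Num.Theory.
Local Open Scope ring_scope.

(* The natural numbers in a gate are the positions of its operands in the list
   of nodes of the computation. [Gle a b] returns 1 if [a <= b] and 0
   otherwise, so that the result of a comparison can be used to select values
   arithmetically. *)
Inductive gate (R I : Type) : Type :=
| Ginput of I
| Gconst of R
| Gadd of nat & nat
| Gsub of nat & nat
| Gmul of nat & nat
| Gdiv of nat & nat
| Gle of nat & nat
| Gsqrt of nat
| Gexp of nat.

Arguments Ginput {R I}.
Arguments Gconst {R I}.
Arguments Gadd {R I}.
Arguments Gsub {R I}.
Arguments Gmul {R I}.
Arguments Gdiv {R I}.
Arguments Gle {R I}.
Arguments Gsqrt {R I}.
Arguments Gexp {R I}.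

Definition operands (R I : Type) (g : gate R I) : seq nat :=
  match g with
  | Ginput _ | Gconst _ => [::]
  | Gadd a b | Gsub a b | Gmul a b | Gdiv a b | Gle a b => [:: a; b]
  | Gsqrt a | Gexp a => [:: a]
  end.

(* A computation with inputs indexed by [I] and outputs indexed by [O]. The
   nodes are listed in a topological order, which is what acyclicity means. *)
Record dag (R : realType) (I O : Type) : Type := Dag {
  nodes : seq (gate R I);
  outnode : O -> nat;
  nodes_topological : forall k, (k < size nodes)%N ->
    all (fun a => (a < k)%N) (operands (nth (Gconst 0) nodes k));
  outnode_valid : forall o, (outnode o < size nodes)%N
}.

(* [gate_value x val g y]: on the input [x], with node values [val], the
   operation [g] is defined and returns [y]. A division by zero or the square
   root of a negative number returns nothing. *)
Definition gate_value (R : realType) (I : Type) (x : I -> R) (val : nat -> R)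
    (g : gate R I) (y : R) : Prop :=
  match g with
  | Ginput i => y = x i
  | Gconst c => y = c
  | Gadd a b => y = val a + val b
  | Gsub a b => y = val a - val b
  | Gmul a b => y = val a * val b
  | Gdiv a b => val b != 0 /\ y = val a / val b
  | Gle a b => y = (val a <= val b)%R%:R
  | Gsqrt a => 0 <= val a /\ y = Num.sqrt (val a)
  | Gexp a => y = expR (val a)
  end.

(* Topological order makes the values of the nodes unique. *)
Definition computes (R : realType) (I O : Type) (G : dag R I O)
    (x : I -> R) (y : O -> R) : Prop :=
  exists val : nat -> R,
    (forall k, (k < size (nodes G))%N ->
       gate_value x val (nth (Gconst 0) (nodes G) k) (val k)) /\
    (forall o, y o = val (outnode G o)).

(* Loading an input or a constant is counted as an operation too. *)
Definition dag_work (R : realType) (I O : Type) (G : dag R I O) : nat :=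
  size (nodes G).

Definition edge (R : realType) (I O : Type) (G : dag R I O) : rel nat :=
  fun a b => a \in operands (nth (Gconst 0) (nodes G) b).

(* A directed path never repeats a node, so bounding the size of the sequences
   by the number of nodes excludes no path. *)
Definition dag_span (R : realType) (I O : Type) (G : dag R I O) : nat :=
  \max_(p : (size (nodes G)).-bseq 'I_(size (nodes G))
        | sorted (fun a b : 'I_(size (nodes G)) => edge G a b) p) size p.

(* The pair [(u, u0)] is the element (u;u0) of R^{d+1}. *)
Notation soc R d := ('rV[R]_d * R^o)%type.

Section SecondOrderCone.
Context {R : realType} {d : nat}.
Implicit Types (u w : 'rV[R]_d).

Definition dotp u w : R := \sum_j u 0 j * w 0 j.

(* The norm that MathComp-Analysis puts on matrices is the maximum norm. *)
Definition enorm u : R := Num.sqrt (\sum_j u 0 j ^+ 2).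

Implicit Type x : soc R d.

Definition soc_eig1 x : R := (Num.sqrt 2)^-1 * (x.2 + enorm x.1).
Definition soc_eig2 x : R := (Num.sqrt 2)^-1 * (x.2 - enorm x.1).

(* For [u = 0] any unit vector will do; this takes the first vector of the
   standard basis, which presupposes [0 < d]. The value of [soc_exp] does not
   depend on the choice, because the two eigenvalues are then equal. *)
Definition soc_dir u : 'rV[R]_d :=
  if u == 0 then \row_j (val j == 0%N)%:R else (enorm u)^-1 *: u.

Definition soc_vec1 x : soc R d :=
  (Num.sqrt 2)^-1 *: ((soc_dir x.1, 1) : soc R d).
Definition soc_vec2 x : soc R d :=
  (Num.sqrt 2)^-1 *: ((- soc_dir x.1, 1) : soc R d).

Definition soc_trace x : R := Num.sqrt 2 * x.2.

Definition soc_exp x : soc R d :=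
  expR (soc_eig1 x) *: soc_vec1 x + expR (soc_eig2 x) *: soc_vec2 x.

Definition soc_id : soc R d := (0, Num.sqrt 2).

End SecondOrderCone.

Section Spheres.
Context {R : realType} {n d : nat}.
Variables (v : 'I_n -> 'rV[R]_d) (gam : 'I_n -> R).

Definition encloses (u : 'rV[R]_d) (g : R) : Prop :=
  forall i, enorm (u - v i) <= g - gam i.

Definition opt_radius : R := inf [set g : R | exists u, encloses u g].

(* [i1] is the index of the first sphere, so that [i != i1] stands for
   [i >= 2]. Elements of the product of cones are families over ['I_n] of
   which only the components [i != i1] are ever used. *)
Variable i1 : 'I_n.
Implicit Types (p : 'I_n -> soc R d) (u : nat -> 'rV[R]_d).

(* All terms are nonnegative, so the default value 0 is harmless. *)
Definition diam : R :=
  \big[Num.max/0]_(i | i != i1) (enorm (v i1 - v i) + gam i1 + gam i).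

Definition jordan_rank : R := (2 * n.-1)%:R.
Definition Rbound : R := Num.sqrt 2.
Definition rho : R := 3 * diam / Num.sqrt 2.

Definition iterations (alpha eps : R) : nat :=
  `|Num.ceil (4 * Rbound ^+ 2 * rho ^+ 2 * ln jordan_rank
              / (eps ^+ 2 * alpha ^+ 2))|%N.

Definition step_size (alpha eps : R) : R :=
  Num.sqrt (ln jordan_rank / (iterations alpha eps)%:R).

Definition prod_trace p : R := \sum_(i | i != i1) soc_trace (p i).

Definition average u (t : nat) : 'rV[R]_d :=
  t%:R^-1 *: \sum_(1 <= s < t.+1) u s.

Definition unnormalized (alpha eps : R) u (t : nat) (i : 'I_n) : soc R d :=
  soc_exp (- (step_size alpha eps * t%:R / rho)
           *: ((average u t - v i, alpha - gam i) : soc R d)).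

(* [primal alpha eps u t] is p^(t), for t >= 1, when the centers found in
   iterations 1, ..., t - 1 are [u 1], ..., [u t.-1]. *)
Definition primal (alpha eps : R) u (t : nat) (i : 'I_n) : soc R d :=
  if (t <= 1)%N then jordan_rank^-1 *: soc_id
  else (prod_trace (unnormalized alpha eps u t.-1))^-1
       *: unnormalized alpha eps u t.-1 i.

Definition sub_objective p (x : 'rV[R]_d) (g : R) : R :=
  dotp (\sum_(i | i != i1) (p i).1) x + g / Num.sqrt 2
  - \sum_(i | i != i1) dotp (v i) (p i).1
  - \sum_(i | i != i1) gam i * (p i).2.

Definition sub_feasible (alpha : R) (x : 'rV[R]_d) (g : R) : Prop :=
  g <= alpha /\ enorm (x - v i1) <= g - gam i1.

Definition sub_optimal (alpha : R) p (x : 'rV[R]_d) (g : R) : Prop :=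
  sub_feasible alpha x g /\
  forall x' g', sub_feasible alpha x' g' ->
    sub_objective p x' g' <= sub_objective p x g.

Definition sub_rejects (alpha : R) p : Prop :=
  (~ exists x g, sub_feasible alpha x g) \/
  (exists x g, sub_optimal alpha p x g /\ sub_objective p x g < 0).

(* Iteration [t] continues with u^(t) = [u t]. The optimal solution need not
   be unique (the objective may not depend on the center); the algorithm may
   use any, hence the relational presentation. *)
Definition continues (alpha eps : R) u (t : nat) : Prop :=
  sub_optimal alpha (primal alpha eps u t) (u t) alpha /\
  0 <= sub_objective (primal alpha eps u t) (u t) alpha.

(* The feasibility test may conclude that the optimal radius exceeds alpha. *)
Definition test_exceeds (alpha eps : R) : Prop :=
  exists u t, (1 <= t <= iterations alpha eps)%N /\
    (forall s, (1 <= s < t)%N -> continues alpha eps u s) /\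
    sub_rejects alpha (primal alpha eps u t).

(* The feasibility test may output the sphere of center [c] and radius [g]. *)
Definition test_outputs (alpha eps : R) (c : 'rV[R]_d) (g : R) : Prop :=
  exists u, (forall t, (1 <= t <= iterations alpha eps)%N ->
               continues alpha eps u t) /\
    c = average u (iterations alpha eps) /\ g = (1 + eps) * alpha.

Record state : Type := State {
  lower : R;
  upper : R;
  center : 'rV[R]_d;
  radius : R
}.

Definition guess (s : state) : R := lower s + 3^-1 * (upper s - lower s).
Definition tolerance (s : state) : R :=
  (3 * guess s)^-1 * (upper s - lower s).

Definition search_step (s s' : state) : Prop :=
  (test_exceeds (guess s) (tolerance s) /\
   s' = State (guess s) (upper s) (center s) (radius s)) \/
  (exists c g, test_outputs (guess s) (tolerance s) c g /\
   s' = State (lower s) ((1 + tolerance s) * guess s) c g).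

Definition init_state : state := State (diam / 2) diam (v i1) diam.

(* Some run of the meta-algorithm with accuracy [eps] outputs the sphere of
   center [c] and radius [g]. The additive error of the stopping rule is
   eps * opt_radius, but an algorithm does not know the optimal radius; it may
   use an estimate [est] of it, between the known lower bound diam / 2 and
   opt_radius. The literal rule is [est = opt_radius]. *)
Definition meta_output (eps : R) (c : 'rV[R]_d) (g : R) : Prop :=
  exists (est : R) (k : nat) (st : nat -> state),
    [/\ diam / 2 <= est <= opt_radius,
        st 0%N = init_state,
        (forall i, (i < k)%N ->
           eps * est < upper (st i) - lower (st i) /\
           search_step (st i) (st i.+1)),
        upper (st k) - lower (st k) <= eps * est
      & c = center (st k) /\ g = radius (st k)].

End Spheres.

Definition sphere_input (R : realType) (n d : nat) (v : 'I_n -> 'rV[R]_d)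
    (gam : 'I_n -> R) (x : 'I_n * 'I_d + 'I_n) : R :=
  match x with
  | inl (i, j) => v i 0 j
  | inr i => gam i
  end.

(* [Some j] is coordinate [j] of the center, [None] is the radius. *)
Definition sphere_output (R : realType) (d : nat) (c : 'rV[R]_d) (g : R)
    (o : option 'I_d) : R :=
  match o with
  | Some j => c 0 j
  | None => g
  end.

(* Main.v *)
Require Import Defs.
From mathcomp Require Import all_boot all_order all_algebra.
From mathcomp Require Import all_classical all_reals all_analysis.
From mathcomp Require Import ring lra zify.

(* Soundness. The feasibility test is a multiplicative-weights method on the
   product of second-order cones: tr exp of the scaled sum of the losses
   (u^(t) - v_i; alpha - gamma_i) is a potential that grows by a factor of at
   most 1 + eta^2 in an iteration of nonnegative value. This follows from the
   Golden-Thompson inequality of the spin factor and from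
   exp x <= 1 + x + x^2. After T iterations the largest eigenvalue of the
   exponent is thus at most 2 ln r, which says that the averaged center is
   within (1 + eps') alpha - gamma_i of every v_i. A rejection is correct
   because the cone is self-dual.

   Complexity. The search interval shrinks by exactly 2/3 in every round and
   starts with length D/2, so with diam / 2 as the estimate of the optimal
   radius the number of rounds, the iteration counts and the step sizes depend
   on n and eps only. One circuit can therefore run all iterations on every
   input and select the results arithmetically; an iteration consists of a
   bounded number of coordinatewise operations and balanced summation trees
   over at most n d leaves, and the iteration counts form a geometric series
   dominated by log n / eps^2. *)

Set Implicit Arguments.
Unset Strict Implicit.
Unset Printing Implicit Defensive.

Import Order.TTheory GRing.Theory Num.Theory.
Import numFieldNormedType.Exports.
Local Open Scope classical_set_scope.
Local Open Scope ring_scope.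

(** * Second-order cones *)


Section Euclid.
Context {R : realType} {d : nat}.
Implicit Types (u w x : 'rV[R]_d) (a : R).

Lemma dotpC u w : dotp u w = dotp w u.
Proof. by apply: eq_bigr => j _; rewrite mulrC. Qed.

Lemma dotpDl u w x : dotp (u + w) x = dotp u x + dotp w x.
Proof. by rewrite /dotp -big_split; apply: eq_bigr => j _; rewrite mxE mulrDl. Qed.

Lemma dotpZl a u x : dotp (a *: u) x = a * dotp u x.
Proof. by rewrite /dotp mulr_sumr; apply: eq_bigr => j _; rewrite mxE mulrA. Qed.

Lemma dotpNl u x : dotp (- u) x = - dotp u x.
Proof. by rewrite -scaleN1r dotpZl mulN1r. Qed.

Lemma dotpDr u w x : dotp x (u + w) = dotp x u + dotp x w.
Proof. by rewrite dotpC dotpDl !(dotpC x). Qed.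

Lemma dotpZr a u x : dotp x (a *: u) = a * dotp x u.
Proof. by rewrite dotpC dotpZl (dotpC x). Qed.

Lemma dotpNr u x : dotp x (- u) = - dotp x u.
Proof. by rewrite dotpC dotpNl (dotpC x). Qed.

Lemma dotp0l x : dotp 0 x = 0.
Proof. by rewrite -(scale0r x) dotpZl mul0r. Qed.

Lemma dotp_suml (I : Type) (r : seq I) (P : pred I) (f : I -> 'rV[R]_d) x :
  dotp (\sum_(i <- r | P i) f i) x = \sum_(i <- r | P i) dotp (f i) x.
Proof.
by elim/big_rec2: _ => [|i a b _ <-]; rewrite ?dotp0l ?dotpDl.
Qed.

Lemma dotpp_ge0 u : 0 <= dotp u u.
Proof. by apply: sumr_ge0 => j _; rewrite -expr2 sqr_ge0. Qed.

Lemma enormE u : enorm u = Num.sqrt (dotp u u).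
Proof. by congr Num.sqrt; apply: eq_bigr => j _; rewrite expr2. Qed.

Lemma enorm_ge0 u : 0 <= enorm u.
Proof. exact: sqrtr_ge0. Qed.

Lemma sqr_enorm u : enorm u ^+ 2 = dotp u u.
Proof. by rewrite enormE sqr_sqrtr// dotpp_ge0. Qed.

Lemma enorm_le u a : 0 <= a -> dotp u u <= a ^+ 2 -> enorm u <= a.
Proof. by move=> a0; rewrite -sqr_enorm ler_sqr// nnegrE enorm_ge0. Qed.

Lemma enorm0 : enorm (0 : 'rV[R]_d) = 0.
Proof. by rewrite enormE dotp0l sqrtr0. Qed.

Lemma enorm_eq0 u : (enorm u == 0) = (u == 0).
Proof.
apply/eqP/eqP => [u0|->]; last exact: enorm0.
have /eqP : dotp u u = 0 by rewrite -sqr_enorm u0 expr0n.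
rewrite psumr_eq0 => [/allP h|j _]; last by rewrite -expr2 sqr_ge0.
apply/rowP => j; rewrite mxE; apply/eqP.
by have := h j (mem_index_enum _); rewrite -expr2 sqrf_eq0.
Qed.

Lemma enorm_gt0 u : (0 < enorm u) = (u != 0).
Proof. by rewrite lt_def enorm_eq0 enorm_ge0 andbT. Qed.

Lemma enormZ a u : enorm (a *: u) = `|a| * enorm u.
Proof.
by rewrite !enormE dotpZl dotpZr mulrA -expr2 sqrtrM ?sqr_ge0// sqrtr_sqr.
Qed.

Lemma enormN u : enorm (- u) = enorm u.
Proof. by rewrite -scaleN1r enormZ normrN normr1 mul1r. Qed.

(** Cauchy-Schwarz: the square of [enorm w *: u - enorm u *: w] equals [2 * (a * b) * (a * b - k)]
    in the notation of the proof, and the first factor is positive once both vectors are nonzero. *)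
Lemma dotp_le u w : dotp u w <= enorm u * enorm w.
Proof.
have [->|u0] := eqVneq u 0; first by rewrite dotp0l enorm0 mul0r.
have [->|w0] := eqVneq w 0; first by rewrite dotpC dotp0l enorm0 mulr0.
have /= := dotpp_ge0 (enorm w *: u - enorm u *: w).
rewrite !(dotpDl, dotpDr, dotpNl, dotpNr, dotpZl, dotpZr) -!sqr_enorm (dotpC w u).
move: u0 w0; rewrite -!enorm_gt0; set a := enorm u; set b := enorm w => a0 b0.
set k := dotp u w => h.
have : 0 <= (2 * (a * b)) * (a * b - k) by nra.
by rewrite pmulr_rge0 ?subr_ge0// !mulr_gt0.
Qed.

Lemma ge_dotp u w : - (enorm u * enorm w) <= dotp u w.
Proof. by rewrite lerNl -dotpNl (le_trans (dotp_le _ _))// enormN. Qed.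

Lemma enormD u w : enorm (u + w) <= enorm u + enorm w.
Proof.
apply: enorm_le; first by rewrite addr_ge0 ?enorm_ge0.
rewrite !(dotpDl, dotpDr) -!sqr_enorm (dotpC w u); have := dotp_le u w; nra.
Qed.

Lemma enorm_sum (I : Type) (r : seq I) (P : pred I) (f : I -> 'rV[R]_d) :
  enorm (\sum_(i <- r | P i) f i) <= \sum_(i <- r | P i) enorm (f i).
Proof.
elim/big_rec2: _ => [|i a b _ h]; first by rewrite enorm0.
by rewrite (le_trans (enormD _ _))// lerD.
Qed.

Lemma enormBC u w : enorm (u - w) = enorm (w - u).
Proof. by rewrite -enormN opprB. Qed.

Lemma enorm_triangle u w x : enorm (u - x) <= enorm (u - w) + enorm (w - x).
Proof. by rewrite (le_trans _ (enormD _ _))// addrA subrK. Qed.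

End Euclid.

(** * Convexity and quadratic bounds for the exponential *)

Section RealExp.
Context {R : realType}.
Implicit Types a b s t x y m : R.

Lemma expr_convex t x y k : 0 <= t <= 1 -> 0 <= x -> 0 <= y ->
  ((1 - t) * x + t * y) ^+ k <= (1 - t) * x ^+ k + t * y ^+ k.
Proof.
move=> t01 x0 y0; elim: k => [|k IH]; first by rewrite !expr0; lra.
have h : 0 <= (1 - t) * x + t * y by rewrite addr_ge0// mulr_ge0//; lra.
rewrite !exprS; apply: (le_trans (ler_wpM2l h IH)).
have hh : 0 <= (x ^+ k - y ^+ k) * (x - y).
  have [xy|/ltW yx] := leP x y.
    by apply: mulr_le0; rewrite subr_le0// lerXn2r.
  by apply: mulr_ge0; rewrite subr_ge0// lerXn2r.
(* This product is exactly the gap between the bound for [k.+1] and the one obtained from the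
   induction hypothesis. *)
have : 0 <= (t * (1 - t)) * ((x ^+ k - y ^+ k) * (x - y)).
  by rewrite mulr_ge0// mulr_ge0//; lra.
move: (x ^+ k) (y ^+ k) => p q; nra.
Qed.

(* cosh (sqrt s) is convex in s because its power series in s has nonnegative
   coefficients; here s = m ^ 2. *)
Lemma cosh_sqrt_convex t x y m : 0 <= t <= 1 ->
  m ^+ 2 = (1 - t) * x ^+ 2 + t * y ^+ 2 ->
  expR m + expR (- m) <=
    (1 - t) * (expR x + expR (- x)) + t * (expR y + expR (- y)).
Proof.
move=> t01 mE.
have cvgE (z : R) : (series (exp_coeff z) \+ series (exp_coeff (- z))) @ \oo -->
              (expR z + expR (- z)).
  by apply: cvgD; exact: is_cvg_series_exp_coeff.
pose F (z : R) := series (exp_coeff z) \+ series (exp_coeff (- z)).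
have c1 := cvgE m.
have c2 : (fun k => (1 - t) * F x k + t * F y k) @ \oo -->
          ((1 - t) * (expR x + expR (- x)) + t * (expR y + expR (- y))).
  by apply: cvgD; apply: cvgMl_tmp; exact: cvgE.
apply: (ler_cvg_to c1 c2); apply: nearW => k; rewrite /F /series /=.
rewrite -!big_split !mulr_sumr -big_split; apply: ler_sum => i _ /=.
rewrite /exp_coeff /= -!mulrDl !mulrA -mulrDl ler_wpM2r// ?invr_ge0 ?ler0n//.
(* Odd terms of the two series cancel and even ones double, which leaves a power series in the
   square of the argument; the claim is then proved term by term. *)
have e (z : R) : z ^+ i + (- z) ^+ i = if odd i then 0 else 2 * (z ^+ 2) ^+ i./2.
  rewrite exprNn -signr_odd; have := odd_double_half i.
  case: (odd i) => <-; first by rewrite expr1 mulN1r subrr.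
  by rewrite add0n doubleK mul1r -mul2n exprM mulr_natl mulr2n.
rewrite !e; case: (odd i); first by rewrite !mulr0 addr0.
rewrite mE [leRHS](_ : _ =
  2 * ((1 - t) * (x ^+ 2) ^+ i./2 + t * (y ^+ 2) ^+ i./2)); last by ring.
by rewrite ler_wpM2l// expr_convex// sqr_ge0.
Qed.

(** Squaring [1 - y / 2 <= expR (- (y / 2))] bounds [expR (- y)] from below. The product of the
    claimed bound with [(1 - y / 2) ^+ 2] is [1 + y ^+ 2 * (1 - 3 * y + y ^+ 2) / 4], which is at
    least 1 because [3 * y <= 1]. *)
Lemma expR_le_quadratic y : `|y| <= 3^-1 -> expR y <= 1 + y + y ^+ 2.
Proof.
move=> hy; have y3 : - 3^-1 <= y <= 3^-1 by rewrite -ler_norml.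
have h1 : 0 < 1 - y / 2 by lra.
have h2 : 1 - y / 2 <= expR (- (y / 2)) by rewrite expR_ge1Dx.
have h3 : (1 - y / 2) ^+ 2 <= expR (- y).
  have -> : expR (- y) = expR (- (y / 2)) ^+ 2.
    by rewrite -expRM_natl; congr expR; lra.
  by rewrite lerXn2r// nnegrE ltW// expR_gt0.
have h4 : 0 < (1 - y / 2) ^+ 2 by rewrite exprn_gt0.
have : expR y * (1 - y / 2) ^+ 2 <= 1.
  by rewrite (le_trans (ler_wpM2l (expR_ge0 y) h3))// -expRD subrr expR0.
have : 1 <= (1 + y + y ^+ 2) * (1 - y / 2) ^+ 2.
  have : 0 <= y ^+ 2 * (1 - 3 * y + y ^+ 2) by rewrite mulr_ge0 ?sqr_ge0//; nra.
  by nra.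
move=> a b; have := le_trans b a; rewrite ler_pM2r//.
Qed.

End RealExp.

(** * Spectral calculus in a single second-order cone *)

Section SOC.
Context {R : realType} {d : nat}.
Implicit Types (x y p : soc R d) (u w : 'rV[R]_d).
Local Notation r2 := (Num.sqrt 2 : R).

Lemma sqrt2_gt0 : 0 < r2. Proof. by rewrite sqrtr_gt0. Qed.
Lemma sqrt2_neq0 : r2 != 0. Proof. by rewrite gt_eqF// sqrt2_gt0. Qed.
Lemma sqr_sqrt2 : r2 ^+ 2 = 2. Proof. by rewrite sqr_sqrtr. Qed.
Lemma sqrt2V2 : r2^-1 ^+ 2 = 2^-1. Proof. by rewrite exprVn sqr_sqrt2. Qed.

Definition socdot x y : R := dotp x.1 y.1 + x.2 * y.2.
Definition in_cone x : Prop := enorm x.1 <= x.2.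

(** One half of self-duality: by Cauchy-Schwarz the vector parts contribute at least minus the
    product of the norms, which the scalar parts outweigh. *)
Lemma socdot_ge0 x y : in_cone x -> in_cone y -> 0 <= socdot x y.
Proof.
rewrite /in_cone /socdot => hx hy; have := ge_dotp x.1 y.1.
have := ler_pM (enorm_ge0 _) (enorm_ge0 _) hx hy; lra.
Qed.

Lemma soc_dir_spec u : enorm u *: soc_dir u = u.
Proof.
rewrite /soc_dir; case: eqVneq => [->|u0]; first by rewrite enorm0 scale0r.
by rewrite scalerA mulfV ?scale1r// enorm_eq0.
Qed.

(** Stated as an inequality because for [d = 0] the direction chosen for the zero vector is empty
    and has norm 0. *)
Lemma enorm_soc_dir u : enorm (soc_dir u) <= 1.
Proof.
rewrite /soc_dir; case: eqVneq => [_|u0]; last first.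
  by rewrite enormZ ger0_norm ?mulVf ?enorm_eq0// invr_ge0 enorm_ge0.
apply: enorm_le => //; rewrite expr1n /dotp.
case: d => [|k]; first by rewrite big_ord0.
rewrite big_ord_recl !mxE/= big1 ?addr0 ?mulr1// => i _.
by rewrite !mxE /= mulr0.
Qed.

Lemma soc_expE x : soc_exp x =
  (((expR (soc_eig1 x) - expR (soc_eig2 x)) / r2) *: soc_dir x.1,
   (expR (soc_eig1 x) + expR (soc_eig2 x)) / r2).
Proof.
rewrite /soc_exp /soc_vec1 /soc_vec2; congr pair => /=.
  by rewrite !scalerA scalerN -scaleNr -scalerDl; congr (_ *: _); ring.
by rewrite /GRing.scale/= ; ring.
Qed.

Lemma soc_trace_exp x :
  soc_trace (soc_exp x) = expR (soc_eig1 x) + expR (soc_eig2 x).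
Proof. by rewrite soc_expE /soc_trace /= mulrCA mulfV ?mulr1// sqrt2_neq0. Qed.

Lemma soc_eig1_lin x : r2 * soc_eig1 x = x.2 + enorm x.1.
Proof. by rewrite /soc_eig1 mulrA mulfV ?mul1r// sqrt2_neq0. Qed.
Lemma soc_eig2_lin x : r2 * soc_eig2 x = x.2 - enorm x.1.
Proof. by rewrite /soc_eig2 mulrA mulfV ?mul1r// sqrt2_neq0. Qed.

Lemma soc_eig2_le x : soc_eig2 x <= soc_eig1 x.
Proof.
apply: ler_wpM2l; first by rewrite invr_ge0 ltW// sqrt2_gt0.
by rewrite lerD2l ge0_cp// enorm_ge0.
Qed.

Lemma in_cone_exp x : in_cone (soc_exp x).
Proof.
rewrite /in_cone soc_expE /= enormZ.
have h : 0 <= (expR (soc_eig1 x) - expR (soc_eig2 x)) / r2.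
  by apply: divr_ge0; rewrite ?subr_ge0 ?ler_expR ?soc_eig2_le// ltW// sqrt2_gt0.
rewrite ger0_norm// (le_trans (ler_piMr h (enorm_soc_dir _)))//.
by rewrite ler_pM2r ?invr_gt0 ?sqrt2_gt0//; have := expR_gt0 (soc_eig2 x); lra.
Qed.

Lemma in_coneZ a x : 0 <= a -> in_cone x -> in_cone (a *: x).
Proof.
by move=> a0; rewrite /in_cone/= enormZ ger0_norm// => h; rewrite ler_wpM2l.
Qed.

Lemma socdotZl a x y : socdot (a *: x) y = a * socdot x y.
Proof. by rewrite /socdot/= dotpZl mulrDr mulrA. Qed.

Lemma socdotZr a x y : socdot x (a *: y) = a * socdot x y.
Proof. by rewrite /socdot/= dotpZr mulrDr mulrCA. Qed.

(* The Golden-Thompson inequality in the spin factor. Both sides depend only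
   on the cosine c of the angle between the two vector parts: the right-hand
   side is affine in c, the left-hand side is convex in c, and they agree for
   c = 1 and c = -1. *)
Lemma golden_thompson x y :
  soc_trace (soc_exp (x + y)) <= socdot (soc_exp x) (soc_exp y).
Proof.
rewrite soc_trace_exp !soc_expE /socdot /= dotpZl dotpZr.
set c := dotp _ _.
have c1 : -1 <= c <= 1.
  have := ge_dotp (soc_dir x.1) (soc_dir y.1).
  have := dotp_le (soc_dir x.1) (soc_dir y.1).
  rewrite -/c.
  have := ler_pM (enorm_ge0 _) (enorm_ge0 _) (enorm_soc_dir x.1) (enorm_soc_dir y.1).
  by lra.
have nE : dotp (x.1 + y.1) (x.1 + y.1) =
    enorm x.1 ^+ 2 + enorm y.1 ^+ 2 + 2 * (enorm x.1 * enorm y.1 * c).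
  rewrite !(dotpDl, dotpDr) -!sqr_enorm (dotpC y.1 x.1).
  have -> : dotp x.1 y.1 = enorm x.1 * enorm y.1 * c.
    by rewrite -{1}(soc_dir_spec x.1) -{1}(soc_dir_spec y.1) dotpZl dotpZr mulrA.
  by ring.
rewrite -sqr_enorm in nE.
pose s := r2^-1; pose A := s * enorm x.1; pose B := s * enorm y.1.
pose M := s * enorm (x.1 + y.1).
(* The squared norm of the sum is affine in the cosine [c]; the weight [(1 - c) / 2] interpolates
   between parallel and antiparallel vector parts. *)
have ME : M ^+ 2 = (1 - (1 - c) / 2) * (A + B) ^+ 2 + (1 - c) / 2 * (A - B) ^+ 2.
  by rewrite /M /A /B exprMn nE; field.
have := @cosh_sqrt_convex _ _ _ _ _ _ ME.
move=> /(_ ltac:(lra)).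
have e1 : soc_eig1 (x + y) = s * x.2 + s * y.2 + M by rewrite /soc_eig1/= -/s /M; ring.
have e2 : soc_eig2 (x + y) = s * x.2 + s * y.2 - M by rewrite /soc_eig2/= -/s /M; ring.
have f1 : soc_eig1 x = s * x.2 + A by rewrite /soc_eig1/= -/s /A; ring.
have f2 : soc_eig2 x = s * x.2 - A by rewrite /soc_eig2/= -/s /A; ring.
have g1 : soc_eig1 y = s * y.2 + B by rewrite /soc_eig1/= -/s /B; ring.
have g2 : soc_eig2 y = s * y.2 - B by rewrite /soc_eig2/= -/s /B; ring.
rewrite e1 e2 f1 f2 g1 g2 opprB opprD !expRD.
have := sqrt2V2; rewrite -/s.
move: (expR_gt0 (s * x.2)) (expR_gt0 (s * y.2)).
move: (expR (s * x.2)) (expR (s * y.2)) (expR A) (expR B) (expR (- A)) (expR (- B))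
 (expR M) (expR (- M)) => P Q a b a' b' m m' P0 Q0 s2 h.
have PQ : 0 <= P * Q by rewrite mulr_ge0 ?ltW.
have := ler_wpM2l PQ h.
rewrite [leLHS](_ : _ = P * Q * m + P * Q * m'); last by ring.
move/le_trans; apply.
rewrite le_eqVlt; apply/orP; left; apply/eqP.
transitivity (s ^+ 2 * (((P * a - P * a') * (Q * b - Q * b') * c) +
  (P * a + P * a') * (Q * b + Q * b'))); last by ring.
by rewrite s2; field.
Qed.

(* Applies exp mu <= 1 + mu + mu^2 on the spectrum of y. *)
Lemma socdot_exp_le p y h : in_cone p -> 0 <= h <= 3^-1 ->
  `|y.2| + enorm y.1 <= r2 * h ->
  socdot p (soc_exp y) <= (1 + h ^+ 2) * soc_trace p + socdot p y.
Proof.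
move=> pc h3 hy.
have bnd z : `|r2 * z| <= r2 * h -> expR z <= 1 + z + h ^+ 2.
  rewrite normrM gtr0_norm ?sqrt2_gt0// ler_pM2l ?sqrt2_gt0// => zh.
  apply: (le_trans (expR_le_quadratic _)); first by lra.
  by rewrite lerD2l -(real_normK (num_real z)) lerXn2r// nnegrE; lra.
have b1 : expR (soc_eig1 y) <= 1 + soc_eig1 y + h ^+ 2.
  apply: bnd; rewrite soc_eig1_lin (le_trans (ler_normD _ _))//.
  by rewrite (ger0_norm (enorm_ge0 _)).
have b2 : expR (soc_eig2 y) <= 1 + soc_eig2 y + h ^+ 2.
  apply: bnd; rewrite soc_eig2_lin (le_trans (ler_normB _ _))//.
  by rewrite (ger0_norm (enorm_ge0 _)).
have k := ge_dotp p.1 (soc_dir y.1); have k' := dotp_le p.1 (soc_dir y.1).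
have kk := ler_pM (enorm_ge0 _) (enorm_ge0 _) pc (enorm_soc_dir y.1).
rewrite mulr1 in kk.
pose c := dotp p.1 (soc_dir y.1).
(* Up to scaling, [p.2 + c] and [p.2 - c] are the weights of [p] on the two spectral directions of
   [y]. They are nonnegative because [p] lies in the cone, so the scalar bounds may be multiplied by
   them. *)
have k1 : 0 <= p.2 + c by rewrite /c; lra.
have k2 : 0 <= p.2 - c by rewrite /c; lra.
have l1 := ler_wpM2r k1 b1; have l2 := ler_wpM2r k2 b2.
have E : socdot p (soc_exp y) = r2^-1 *
    (expR (soc_eig1 y) * (p.2 + c) + expR (soc_eig2 y) * (p.2 - c)).
  by rewrite soc_expE /socdot /= dotpZr -/c; ring.
rewrite E; apply: (@le_trans _ _ (r2^-1 * ((1 + soc_eig1 y + h ^+ 2) * (p.2 + c)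
   + (1 + soc_eig2 y + h ^+ 2) * (p.2 - c)))).
  by apply: ler_wpM2l; [rewrite invr_ge0 ltW// sqrt2_gt0 | exact: lerD].
rewrite le_eqVlt; apply/orP; left; apply/eqP.
have yE : dotp p.1 y.1 = enorm y.1 * c.
  by rewrite -{1}(soc_dir_spec y.1) dotpZr.
rewrite /socdot yE /soc_trace /soc_eig1 /soc_eig2.
have r0 := sqrt2_neq0.
have E1 : r2^-1 * 2 = r2 by rewrite -{2}sqr_sqrt2 expr2 mulKf.
have E2 : r2^-1 * r2^-1 * 2 = 1 by rewrite -mulrA E1 mulVf.
transitivity ((r2^-1 * 2) * ((1 + h ^+ 2) * p.2) +
              (r2^-1 * r2^-1 * 2) * (enorm y.1 * c + p.2 * y.2)); first by ring.
by rewrite E1 E2; ring.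
Qed.

End SOC.

(** * Soundness of the meta-algorithm *)


Section Soundness.
Context {R : realType} {n d : nat}.
Variables (v : 'I_n -> 'rV[R]_d) (gam : 'I_n -> R) (i1 : 'I_n).
Hypothesis n_ge2 : (2 <= n)%N.
Hypothesis gam_ge0 : forall i, 0 <= gam i.
Implicit Types (p : 'I_n -> soc R d) (u : nat -> 'rV[R]_d) (c x : 'rV[R]_d).
Implicit Types (alpha eps g : R) (t : nat).
Local Notation D := (diam v gam i1).
Local Notation opt := (opt_radius v gam).
Local Notation r2 := (Num.sqrt 2 : R).
Local Notation rk := (@jordan_rank R n).

Lemma exists_other : exists i, i != i1.
Proof.
apply/existsP; rewrite -negb_forall; apply/negP => /forallP h.
have /eq_card : ('I_n : predArgType) =i pred1 i1 by move=> i; rewrite !inE h.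
by rewrite card1 card_ord => n1; move: (n_ge2); rewrite n1.
Qed.

Lemma diam_ge0 : 0 <= D.
Proof. exact: bigmax_ge_id. Qed.

Lemma le_diam i : i != i1 -> enorm (v i1 - v i) + gam i1 + gam i <= D.
Proof.
move=> ii; exact: (le_bigmax_cond 0
  (fun i => enorm (v i1 - v i) + gam i1 + gam i)).
Qed.

Lemma gam_le_diam i : gam i <= D.
Proof.
have [->|ii] := eqVneq i i1; last first.
  have := le_diam ii; have := enorm_ge0 (v i1 - v i); have := gam_ge0 i1; lra.
have [j jj] := exists_other.
have := le_diam jj; have := enorm_ge0 (v i1 - v j); have := gam_ge0 j; lra.
Qed.

Lemma encloses_diam : encloses v gam (v i1) D.
Proof.
move=> i; have [->|ii] := eqVneq i i1.
  by rewrite subrr enorm0 subr_ge0 gam_le_diam.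
have := le_diam ii; have := gam_ge0 i1; lra.
Qed.

Lemma encloses_radius_ge c g : encloses v gam c g -> D / 2 <= g.
Proof.
move=> h; have h1 := h i1; have := enorm_ge0 (c - v i1); have := gam_ge0 i1.
move=> g1 e1; suff : D <= 2 * g by lra.
(* The default value 0 of the maximum requires [0 <= 2 * g], which the constraint of the first
   sphere provides. *)
apply: bigmax_le => [|i _]; first by lra.
have := enorm_triangle (v i1) c (v i); rewrite (enormBC (v i1) c); have := h i; lra.
Qed.

Lemma le_opt a : (forall c g, encloses v gam c g -> a <= g) -> a <= opt.
Proof.
move=> h; apply: lb_le_inf; first by exists D, (v i1); exact: encloses_diam.
by move=> y [x /h].
Qed.

Lemma diam_le_opt : D / 2 <= opt.
Proof. by apply: le_opt => c g /encloses_radius_ge. Qed.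

Lemma natmul_average u t : t%:R *: average u t = \sum_(1 <= s < t.+1) u s.
Proof.
case: t => [|t]; first by rewrite scale0r big_geq.
by rewrite /average scalerA mulfV ?scale1r// pnatr_eq0.
Qed.

(** The sum of the first [t] losses. Unlike the average in the algorithm, it changes by a single
    summand per iteration, which is the form that the potential argument needs. *)
Definition cumulative alpha u t i : soc R d :=
  (\sum_(1 <= s < t.+1) u s - t%:R *: v i, t%:R * (alpha - gam i)).

Lemma unnormalizedE alpha eps u t i :
  unnormalized v gam i1 alpha eps u t i =
  soc_exp ((- (step_size v gam i1 alpha eps / rho v gam i1))
           *: cumulative alpha u t i).
Proof.
congr soc_exp; rewrite mulrAC -mulNr -scalerA; congr (_ *: _).
by congr pair; rewrite scalerBr natmul_average.
Qed.

Lemma jordan_rankE : rk = (2 * (n.-1)%:R) :> R.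
Proof. by rewrite /jordan_rank natrM. Qed.

Lemma jordan_rank_ge2 : 2 <= rk.
Proof.
rewrite jordan_rankE -[leLHS]mulr1 ler_pM2l// ler1n.
by case: n n_ge2 => [|[|k]].
Qed.

Lemma soc_exp0 : soc_exp (0 : soc R d) = soc_id.
Proof.
rewrite soc_expE /soc_id /soc_eig1 /soc_eig2 /= enorm0 subr0 addr0 mulr0 expR0.
by rewrite subrr mul0r scale0r -[X in X / _]sqr_sqrt2 expr2 mulfK// sqrt2_neq0.
Qed.

Lemma unnormalized0 alpha eps u i : unnormalized v gam i1 alpha eps u 0 i = soc_id.
Proof.
by rewrite /unnormalized mulr0 mul0r oppr0 scale0r soc_exp0.
Qed.

Lemma prod_trace_unnormalized0 alpha eps u :
  prod_trace i1 (unnormalized v gam i1 alpha eps u 0) = rk.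
Proof.
rewrite /prod_trace (eq_bigr (fun=> 2)) => [|i _]; last first.
  by rewrite unnormalized0 /soc_trace/= -expr2 sqr_sqrt2.
by rewrite sumr_const cardC1 card_ord jordan_rankE mulr_natr.
Qed.

Lemma prod_trace_unnormalized_gt0 alpha eps u t :
  0 < prod_trace i1 (unnormalized v gam i1 alpha eps u t).
Proof.
have [j jj] := exists_other; rewrite /prod_trace (bigD1 j)//=.
apply: ltr_wpDr; last by rewrite soc_trace_exp addr_gt0 ?expR_gt0.
by apply: sumr_ge0 => i _; rewrite soc_trace_exp addr_ge0 ?expR_ge0.
Qed.

(** The starting point is no exception: the exponential of zero is the identity, and the trace of
    the identity of the product is [jordan_rank]. *)
Lemma primalE alpha eps u t i : primal v gam i1 alpha eps u t i =
  (prod_trace i1 (unnormalized v gam i1 alpha eps u t.-1))^-1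
     *: unnormalized v gam i1 alpha eps u t.-1 i.
Proof.
rewrite /primal; case: leqP => // t1.
have -> : t.-1 = 0%N by case: t t1 => [|[|]].
by rewrite prod_trace_unnormalized0 unnormalized0.
Qed.

Lemma in_cone_primal alpha eps u t i :
  in_cone (primal v gam i1 alpha eps u t i).
Proof.
rewrite primalE; apply: in_coneZ; last exact: in_cone_exp.
by rewrite invr_ge0 ltW// prod_trace_unnormalized_gt0.
Qed.

Lemma prod_traceZ a p :
  prod_trace i1 (fun i => a *: p i) = a * prod_trace i1 p.
Proof.
rewrite /prod_trace mulr_sumr; apply: eq_bigr => i _.
by rewrite /soc_trace/= mulrCA.
Qed.

Lemma prod_trace_primal alpha eps u t :
  prod_trace i1 (primal v gam i1 alpha eps u t) = 1.
Proof.
rewrite (funext (primalE alpha eps u t)).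
by rewrite prod_traceZ mulVf// gt_eqF// prod_trace_unnormalized_gt0.
Qed.

Lemma eig1_le_prod_trace (y : 'I_n -> soc R d) i : i != i1 ->
  expR (soc_eig1 (y i)) <= prod_trace i1 (fun j => soc_exp (y j)).
Proof.
move=> ii; rewrite /prod_trace (bigD1 i)//= [X in _ <= X + _]soc_trace_exp -addrA lerDl.
apply: addr_ge0; first exact: expR_ge0.
by apply: sumr_ge0 => j _; rewrite soc_trace_exp addr_ge0 ?expR_ge0.
Qed.

(* Trace one is what turns the term g / sqrt 2 into the pairing with g. *)
Lemma sub_objectiveE p x g : prod_trace i1 p = 1 ->
  sub_objective v gam i1 p x g =
  \sum_(i | i != i1) socdot (p i) (x - v i, g - gam i).
Proof.
move=> p1; rewrite /sub_objective /socdot/=.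
have -> : g / r2 = \sum_(i | i != i1) (p i).2 * g.
  rewrite -mulr_suml mulrC; congr (_ * _).
  have h : r2 * (\sum_(i | i != i1) ((p i).2 : R)) = 1.
    by rewrite mulr_sumr -[RHS]p1.
  by rewrite -[LHS]mulr1 -[X in _ * X]h mulKf ?sqrt2_neq0.
rewrite dotp_suml -big_split -!sumrB; apply: eq_bigr => i _ /=.
by rewrite dotpDr dotpNr (dotpC (v i)); ring.
Qed.

(** Weak duality. An enclosing sphere of radius at most [alpha] would be feasible for the
    subproblem, and its objective value, a sum of pairings of cone elements, would be
    nonnegative. *)
Lemma sub_rejects_lt alpha eps u t c g :
  sub_rejects v gam i1 alpha (primal v gam i1 alpha eps u t) ->
  encloses v gam c g -> alpha < g.
Proof.
set p := primal _ _ _ _ _ _ _ => rej h; rewrite ltNge; apply/negP => ga.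
have feas : sub_feasible v gam i1 alpha c g by split => //; exact: h.
case: rej => [[]|[x [g' [[_ opt] neg]]]]; first by exists c, g.
have := le_lt_trans (opt _ _ feas) neg; apply/negP; rewrite -leNgt.
rewrite sub_objectiveE ?prod_trace_primal//; apply: sumr_ge0 => i _.
by apply: socdot_ge0; [exact: in_cone_primal | exact: h].
Qed.

Lemma test_exceeds_le_opt alpha eps :
  test_exceeds v gam i1 alpha eps -> alpha <= opt.
Proof.
case=> u [t [_ [_ rej]]]; apply: le_opt => c g /(sub_rejects_lt rej).
exact: ltW.
Qed.

(** * Potential argument for one feasibility test *)

Section Regret.
Variables (alpha eps : R).
Hypothesis D_gt0 : 0 < D.
Hypothesis alpha_gt0 : 0 < alpha.
Hypothesis alpha_le : alpha <= D.
Hypothesis eps_gt0 : 0 < eps.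
Hypothesis eps_alpha_le : eps * alpha <= D.
Local Notation T := (iterations v gam i1 alpha eps).
Local Notation eta := (step_size v gam i1 alpha eps).

(** The factor 36 is 4 times 2 (the square of [Rbound]) times 9/2 (from the square of [rho]). *)
Lemma iterations_ge :
  36 * D ^+ 2 * ln rk / (eps * alpha) ^+ 2 <= T%:R.
Proof.
have -> : (T%:R : R) = (Num.ceil (4 * Rbound ^+ 2 * rho v gam i1 ^+ 2
   * ln rk / (eps ^+ 2 * alpha ^+ 2)))%:~R.
  (* The absolute value in [iterations] leaves the ceiling unchanged, since its argument is
     nonnegative. *)
  rewrite /T -[LHS]mulrz_nat natz gez0_abs// ceil_ge0.
  apply: (@lt_le_trans _ _ 0) => //.
  apply: divr_ge0; first apply: mulr_ge0.
  - by do 2 (apply: mulr_ge0; last exact: sqr_ge0).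
  - by rewrite ln_ge0//; have := jordan_rank_ge2; lra.
  - by apply: mulr_ge0; exact: sqr_ge0.
apply: le_trans (ceil_ge _); rewrite le_eqVlt; apply/orP; left; apply/eqP.
rewrite /Rbound /rho !exprMn exprVn sqr_sqrt2; field.
by rewrite !gt_eqF.
Qed.

Lemma ln_rank_gt0 : 0 < ln rk :> R.
Proof. by apply: ln_gt0; have := jordan_rank_ge2; lra. Qed.

Lemma iterations_gt0 : 0 < T%:R :> R.
Proof.
apply: lt_le_trans iterations_ge.
by rewrite divr_gt0 ?exprn_gt0 ?mulr_gt0 ?exprn_gt0// ln_rank_gt0.
Qed.

Lemma sqr_step_size : eta ^+ 2 * T%:R = ln rk.
Proof.
rewrite /step_size sqr_sqrtr; last first.
  by rewrite divr_ge0 ?ltW// ?ln_rank_gt0// iterations_gt0.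
by rewrite divfK// gt_eqF// iterations_gt0.
Qed.

Lemma step_size_gt0 : 0 < eta.
Proof. by rewrite sqrtr_gt0 divr_gt0 ?iterations_gt0 ?ln_rank_gt0. Qed.

(** The purpose of the choice of [T]: after squaring and multiplying by [T], the left side is
    [36 * D ^+ 2 * ln rk]. *)
Lemma step_size_le : 6 * D * eta <= eps * alpha.
Proof.
have ea : 0 < eps * alpha by rewrite mulr_gt0.
have De : 0 < 6 * D * eta by rewrite !mulr_gt0 ?step_size_gt0.
rewrite -ler_sqr ?nnegrE ?(ltW De) ?(ltW ea)// -(ler_pM2r iterations_gt0).
rewrite exprMn -mulrA sqr_step_size.
have := iterations_ge; rewrite ler_pdivrMr ?exprn_gt0// [in leRHS]mulrC.
by apply: le_trans; rewrite le_eqVlt; apply/orP; left; apply/eqP; ring.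
Qed.

Lemma step_size_le_third : eta <= 3^-1.
Proof.
have : 6 * D * eta <= D by rewrite (le_trans step_size_le).
by move=> h; rewrite -(ler_pM2l D_gt0); move: (D_gt0); lra.
Qed.

Lemma rho_gt0 : 0 < rho v gam i1.
Proof. by rewrite divr_gt0 ?sqrt2_gt0// mulr_gt0. Qed.

Lemma cumulativeS u t i : cumulative alpha u t.+1 i =
  cumulative alpha u t i + (u t.+1 - v i, alpha - gam i).
Proof.
congr pair; last by rewrite -natr1 mulrDl mul1r.
rewrite big_nat_recr//= -natr1 scalerDl scale1r opprD.
by rewrite !addrA; congr (_ + _); rewrite addrAC.
Qed.

(** Explains [rho]: divided by the square root of 2, this bounds both eigenvalues of every loss by
    [rho] in absolute value. The scalar part may be negative, hence the case distinction. *)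
Lemma loss_width i x : i != i1 -> enorm (x - v i1) <= alpha - gam i1 ->
  `|alpha - gam i| + enorm (x - v i) <= 3 * D.
Proof.
move=> ii hx; have := le_diam ii; have := enorm_triangle x (v i1) (v i).
have := gam_ge0 i; have := gam_ge0 i1.
move: hx D_gt0 alpha_le.
move: (enorm (x - v i1)) (enorm (x - v i)) (enorm (v i1 - v i)) D.
move: (gam i) (gam i1) => g g1 a b c D'.
by case: (ger0P (alpha - g)) => h; lra.
Qed.

Lemma potentialS u t : continues v gam i1 alpha eps u t.+1 ->
  prod_trace i1 (unnormalized v gam i1 alpha eps u t.+1) <=
  (1 + eta ^+ 2) * prod_trace i1 (unnormalized v gam i1 alpha eps u t).
Proof.
move=> [[[_ feas] _] obj_ge0].
pose un i := unnormalized v gam i1 alpha eps u t i.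
pose M i : soc R d := (u t.+1 - v i, alpha - gam i).
pose k := eta / rho v gam i1.
have k0 : 0 <= k by rewrite divr_ge0 ?ltW ?step_size_gt0 ?rho_gt0.
(* Acceptance of the iteration, with the positive normalizing factor removed. *)
have obj : 0 <= \sum_(i | i != i1) socdot (un i) (M i).
  move: obj_ge0; rewrite sub_objectiveE ?prod_trace_primal//.
  under eq_bigr do rewrite primalE socdotZl.
  by rewrite -mulr_sumr pmulr_rge0// invr_gt0 prod_trace_unnormalized_gt0.
(* Golden-Thompson splits off the newest loss, and the quadratic bound for the exponential applies
   to it with [h] equal to [eta]. After summation the linear term is a nonpositive multiple of [obj]
   and is dropped. *)
have step i : i != i1 -> soc_trace (unnormalized v gam i1 alpha eps u t.+1 i) <=
    (1 + eta ^+ 2) * soc_trace (un i) - k * socdot (un i) (M i).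
  move=> ii; rewrite unnormalizedE cumulativeS scalerDr.
  apply: (le_trans (golden_thompson _ _)); rewrite -unnormalizedE.
  rewrite -(mulNr k) -socdotZr.
  apply: socdot_exp_le; first exact: in_cone_exp.
    by rewrite ltW ?step_size_gt0//= step_size_le_third.
  rewrite /= enormZ normrM normrN (ger0_norm k0) -mulrDr.
  apply: (le_trans (ler_wpM2l k0 (loss_width ii feas))).
  rewrite le_eqVlt; apply/orP; left; apply/eqP.
  have -> : 3 * D = rho v gam i1 * r2 by rewrite divfK// sqrt2_neq0.
  by rewrite /k mulrA divfK ?gt_eqF ?rho_gt0// mulrC.
apply: (le_trans (ler_sum _ step)).
rewrite sumrB -[X in X - _]mulr_sumr -[X in _ - X]mulr_sumr lerBlDr.
by apply: ler_wpDr; [exact: mulr_ge0 | exact: lexx].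
Qed.

Lemma potential_le u t :
  (forall s, (1 <= s <= t)%N -> continues v gam i1 alpha eps u s) ->
  prod_trace i1 (unnormalized v gam i1 alpha eps u t) <=
  (1 + eta ^+ 2) ^+ t * rk.
Proof.
elim: t => [|t IH] h; first by rewrite prod_trace_unnormalized0 mul1r.
apply: (le_trans (potentialS (h t.+1 (leqnn _)))).
rewrite (exprS _ t) -[leRHS]mulrA; apply: ler_wpM2l; first by rewrite addr_ge0 ?sqr_ge0.
by apply: IH => s /andP[s1 st]; apply: h; rewrite s1 leqW.
Qed.

Lemma test_outputs_encloses c g :
  test_outputs v gam i1 alpha eps c g -> encloses v gam c g.
Proof.
case=> u [cont [-> ->]] i; set a := average u T.
have aT : T%:R *: a = \sum_(1 <= s < T.+1) u s by exact: natmul_average.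
have T0 := iterations_gt0; have ea : 0 < eps * alpha by rewrite mulr_gt0.
(* The first sphere does not enter the potential; every single center satisfies its constraint,
   hence so does the average, by convexity of the norm. *)
have [->|ii] := eqVneq i i1.
  suff : T%:R * enorm (a - v i1) <= T%:R * (alpha - gam i1).
    by rewrite ler_pM2l// => h; lra.
  rewrite -{1}(ger0_norm (ltW T0)) -enormZ scalerBr aT.
  have -> : T%:R *: v i1 = \sum_(1 <= s < T.+1) v i1.
    by rewrite sumr_const_nat subSS subn0 scaler_nat.
  rewrite -sumrB (le_trans (enorm_sum _ _ _))//.
  have -> : T%:R * (alpha - gam i1) = \sum_(1 <= s < T.+1) (alpha - gam i1).
    by rewrite sumr_const_nat subSS subn0 mulr_natl.
  by rewrite big_nat [leRHS]big_nat; apply: ler_sum => s hs; case: (cont s hs) => -[[]].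
pose k := eta / rho v gam i1.
have k0 : 0 < k by rewrite divr_gt0 ?step_size_gt0 ?rho_gt0.
pose y := (- k) *: cumulative alpha u T i.
have rk0 : 0 < rk by apply: lt_le_trans jordan_rank_ge2.
(* The potential starts at [rk] and grows by a factor of at most [expR (eta ^+ 2 * T%:R)], which is
   again [rk]. *)
have lam : soc_eig1 y <= 2 * ln rk.
  rewrite -ler_expR mulrDl mul1r expRD lnK//.
  have := eig1_le_prod_trace (fun j => (- k) *: cumulative alpha u T j) ii.
  rewrite -(funext (unnormalizedE alpha eps u T)) => /le_trans; apply.
  apply: (le_trans (potential_le cont)); apply: (ler_wpM2r (ltW rk0)).
  apply: (@le_trans _ _ (expR (eta ^+ 2) ^+ T)).
    by rewrite lerXn2r ?nnegrE ?addr_ge0 ?sqr_ge0 ?expR_ge0// expR_ge1Dx.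
  by rewrite -expRM_natl mulrC sqr_step_size lnK.
have yE : r2 * soc_eig1 y = k * T%:R * (enorm (a - v i) - (alpha - gam i)).
  rewrite soc_eig1_lin /y /cumulative /= -aT -scalerBr !enormZ normrN.
  by rewrite (gtr0_norm k0) (gtr0_norm T0) /GRing.scale/=; ring.
(* This is [lam] multiplied by [r2 * rho], which is [3 * D], with [ln rk] rewritten as
   [eta ^+ 2 * T%:R]. *)
have key : eta * T%:R * (enorm (a - v i) - (alpha - gam i)) <=
           eta * T%:R * (6 * D * eta).
  have e0 : 0 <= r2 * rho v gam i1 by rewrite mulr_ge0 ?ltW ?sqrt2_gt0 ?rho_gt0.
  have := ler_wpM2l e0 lam; rewrite mulrAC yE -sqr_step_size.
  have -> : k * T%:R * (enorm (a - v i) - (alpha - gam i)) * rho v gam i1 =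
    eta * T%:R * (enorm (a - v i) - (alpha - gam i)).
    by rewrite /k; field; rewrite gt_eqF// rho_gt0.
  move/le_trans; apply; rewrite le_eqVlt; apply/orP; left; apply/eqP.
  by rewrite /rho; field; exact: sqrt2_neq0.
have := key; rewrite ler_pM2l ?mulr_gt0 ?step_size_gt0// => h.
have := step_size_le; lra.
Qed.

End Regret.

Definition search_invariant (s : state) : Prop :=
  [/\ D / 2 <= lower s, lower s <= upper s, upper s <= D, lower s <= opt &
      encloses v gam (Defs.center s) (Defs.radius s) /\ Defs.radius s = upper s].

Lemma guess_tolerance (s : @state R d) : 0 < guess s ->
  tolerance s * guess s = (upper s - lower s) / 3.
Proof. by move=> g0; rewrite /tolerance; field; rewrite gt_eqF. Qed.

Lemma search_invariantS s s' : lower s < upper s ->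
  search_invariant s -> search_step v gam i1 s s' -> search_invariant s'.
Proof.
move=> lu [Dl _ uD lopt [enc rad]].
have D0 := diam_ge0.
have g0 : 0 < guess s by rewrite /guess; lra.
have tg := guess_tolerance g0.
case=> [[/test_exceeds_le_opt ge ->]|[c [g [out ->]]]].
  by split => //=; rewrite /guess; lra.
have [_ [_ [_ gE]]] := out.
split => //=; try by rewrite mulrDl mul1r tg /guess; lra.
split => //; apply: test_outputs_encloses out => //.
- by lra.
- by rewrite /guess; lra.
- by rewrite /tolerance mulr_gt0 ?invr_gt0 ?mulr_gt0//; lra.
- by rewrite tg; lra.
Qed.

(** The radius returned is the upper end of an interval whose lower end is at most the optimum and
    whose length is at most [eps * est], with [est] at most the optimum. *)
Lemma meta_output_sound eps c g : 0 <= eps ->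
  meta_output v gam i1 eps c g ->
  encloses v gam c g /\ g <= (1 + eps) * opt.
Proof.
move=> eps0 [est [k [st [/andP[De eo] st0 step stop [-> ->]]]]].
have est0 : 0 <= est by have := diam_ge0; lra.
have inv i : (i <= k)%N -> search_invariant (st i).
  elim: i => [_|i IH ik].
    rewrite st0; split => //=; [by have := diam_ge0; lra|exact: diam_le_opt|].
    by split=> //; exact: encloses_diam.
  have [gap ss] := step _ ik; apply: (search_invariantS _ (IH (ltnW ik)) ss).
  by rewrite -subr_gt0 (le_lt_trans _ gap)// mulr_ge0.
have [_ _ _ lopt [enc rE]] := inv k (leqnn k); split=> //; rewrite rE.
rewrite mulrDl mul1r (le_trans _ (lerD lopt (ler_wpM2l eps0 eo)))//.
by rewrite -lerBlDl.
Qed.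

End Soundness.

(** * Circuits of bounded work and span *)


Section Circuits.
Context {R : realType} {I T : Type}.
Variable inp : T -> I -> R.
Implicit Types (gs : seq (gate R I)) (val : T -> nat -> R) (dp : nat -> nat).
Implicit Types (S : set (T -> R)) (w s k m c : nat).

Local Notation gate_at gs k := (nth (Gconst 0) gs k).

(* [dp] labels the nodes so that labels increase along edges; the largest
   label bounds the span. *)
Definition circuit gs val dp w s : Prop :=
  [/\ (size gs <= w)%N,
      forall k, (k < size gs)%N -> (0 < dp k <= s)%N,
      forall k, (k < size gs)%N ->
        all (fun a => (a < k)%N && (dp a < dp k)%N) (operands (gate_at gs k)) &
      forall x k, (k < size gs)%N ->
        gate_value (inp x) (val x) (gate_at gs k) (val x k)].

(* A wire is identified with the function of the instance that it carries, so
   that a set [S] of functions can record what a circuit has computed. *)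
Definition available gs val (f : T -> R) : Prop :=
  exists2 k, (k < size gs)%N & forall x, val x k = f x.

Definition computable w s S : Prop :=
  exists gs val dp, circuit gs val dp w s /\ forall f, S f -> available gs val f.

Inductive one_gate S : (T -> R) -> Prop :=
| one_input i : one_gate S (fun x => inp x i)
| one_const a : one_gate S (fun=> a)
| one_add f g : S f -> S g -> one_gate S (fun x => f x + g x)
| one_sub f g : S f -> S g -> one_gate S (fun x => f x - g x)
| one_mul f g : S f -> S g -> one_gate S (fun x => f x * g x)
| one_div f g : S f -> S g -> (forall x, g x != 0) ->
    one_gate S (fun x => f x / g x)
| one_le f g : S f -> S g -> one_gate S (fun x => (f x <= g x)%R%:R)
| one_sqrt f : S f -> (forall x, 0 <= f x) ->
    one_gate S (fun x => Num.sqrt (f x))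
| one_exp f : S f -> one_gate S (fun x => expR (f x)).

Lemma gate_value_ext (z : I -> R) (val val' : nat -> R) (g : gate R I) y :
  {in operands g, val =1 val'} -> gate_value z val g y -> gate_value z val' g y.
Proof.
by case: g => //= [a b|a b|a b|a b|a b|a|a] h;
  rewrite -?h ?inE ?eqxx ?orbT.
Qed.

Lemma one_gateP S gs val f :
  (forall g, S g -> available gs val g) -> one_gate S f ->
  exists g : gate R I, all (fun a => (a < size gs)%N) (operands g) /\
    forall x, gate_value (inp x) (val x) g (f x).
Proof.
move=> av; case.
- by move=> i; exists (Ginput i).
- by move=> a; exists (Gconst a).
- move=> {}f g /av[a sa fa] /av[b sb gb]; exists (Gadd a b).
  by rewrite /= sa sb; split=> // x; rewrite fa gb.
- move=> {}f g /av[a sa fa] /av[b sb gb]; exists (Gsub a b).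
  by rewrite /= sa sb; split=> // x; rewrite fa gb.
- move=> {}f g /av[a sa fa] /av[b sb gb]; exists (Gmul a b).
  by rewrite /= sa sb; split=> // x; rewrite fa gb.
- move=> {}f g /av[a sa fa] /av[b sb gb] g0; exists (Gdiv a b).
  by rewrite /= sa sb; split=> // x; rewrite fa gb.
- move=> {}f g /av[a sa fa] /av[b sb gb]; exists (Gle a b).
  by rewrite /= sa sb; split=> // x; rewrite fa gb.
- move=> {}f /av[a sa fa] f0; exists (Gsqrt a).
  by rewrite /= sa; split=> // x; rewrite fa.
- move=> {}f /av[a sa fa]; exists (Gexp a).
  by rewrite /= sa; split=> // x; rewrite fa.
Qed.

(** Gates that read only existing nodes are independent of each other, so all of them can be
    appended with the common label [s.+1]. *)
Lemma computable_layer (F : finType) w s S (f : F -> T -> R) :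
  computable w s S -> (forall i, one_gate S (f i)) ->
  computable (w + #|F|) s.+1 (S `|` range f).
Proof.
move=> [gs [val [dp [[szw dps ops vals] av]]]] og.
have /choice[g gP] i := one_gateP av (og i).
pose N := size gs.
pose gs' := gs ++ [seq g i | i <- enum F].
pose val' x k := if (k < N)%N then val x k
                 else nth 0 [seq f i x | i <- enum F] (k - N).
pose dp' k := if (k < N)%N then dp k else s.+1.
have sz' : size gs' = (N + #|F|)%N by rewrite size_cat size_map cardE.
have new k : (k < N + #|F|)%N -> ~~ (k < N)%N -> exists2 i,
    gate_at gs' k = g i & forall x, val' x k = f i x.
  move=> kN; rewrite -leqNgt => Nk.
  have kF : (k - N < size (enum F))%N by rewrite -cardE ltn_subLR.
  have [i0 _] : exists i0 : F, i0 \in enum F.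
    by case: (enum F) kF => // i0 e _; exists i0; rewrite mem_head.
  exists (nth i0 (enum F) (k - N)) => [|x].
    by rewrite /gs' nth_cat ltnNge Nk/= (nth_map i0).
  by rewrite /val' ltnNge Nk/= (nth_map i0).
exists gs', val', dp'; split.
  split.
  - by rewrite sz' leq_add2r.
  - move=> k _; rewrite /dp'; case: ifP => [/dps/andP[-> /leqW]//|_].
    by rewrite leqnn.
  - move=> k; rewrite sz' => kN; case: (boolP (k < N)%N) => kk.
      rewrite /gs' nth_cat kk; apply: sub_all (ops k kk) => a /andP[ak dd].
      by rewrite ak /dp' kk (ltn_trans ak kk).
    have [i -> _] := new k kN kk; apply: sub_all (gP i).1 => a aN.
    rewrite /dp' aN (negbTE kk); rewrite -leqNgt in kk.
    by rewrite (leq_trans aN kk) ltnS; have /andP[] := dps a aN.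
  - move=> x k; rewrite sz' => kN; case: (boolP (k < N)%N) => kk.
      rewrite /gs' nth_cat kk {2}/val' kk; apply: gate_value_ext (vals x k kk).
      move=> a /(allP (ops k kk))/andP[ak _].
      by rewrite /val' (ltn_trans ak kk).
    have [i -> ->] := new k kN kk; apply: gate_value_ext ((gP i).2 x).
    by move=> a /(allP (gP i).1) aN; rewrite /val' aN.
move=> h [/av[k kk vk]|[i _ <-]].
  exists k; first by rewrite sz' ltn_addr.
  by move=> x; rewrite /val' kk.
have iF : (enum_rank i < size (enum F))%N by rewrite -cardE ltn_ord.
exists (N + enum_rank i)%N; first by rewrite sz' ltn_add2l ltn_ord.
move=> x; rewrite /val' ltnNge leq_addr/= addKn (nth_map i)//.
by rewrite nth_enum_rank.
Qed.

Lemma computable0 : computable 0 0 set0.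
Proof. by exists [::], (fun _ _ => 0), (fun=> 0%N); split. Qed.

Lemma computableW w s w' s' S S' : (w <= w')%N -> (s <= s')%N -> S' `<=` S ->
  computable w s S -> computable w' s' S'.
Proof.
move=> ww ss sub [gs [val [dp [[szw dps ops vals] av]]]].
exists gs, val, dp; split; last by move=> f /sub/av.
split => //; first exact: leq_trans ww.
by move=> k /dps/andP[-> h]; exact: leq_trans ss.
Qed.

(* One expression for the whole family, so that the members can be evaluated
   in parallel, with one layer of gates for each of its [m] operations. *)
Inductive expressible (F : Type) S : nat -> (F -> T -> R) -> Prop :=
| expressible_in f : (forall i, S (f i)) -> expressible S 0 f
| expressible_input (h : F -> I) : expressible S 1 (fun i x => inp x (h i))
| expressible_const (a : F -> R) : expressible S 1 (fun i _ => a i)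
| expressible_sub m m' f g : expressible S m f -> expressible S m' g ->
    expressible S (m + m').+1 (fun i x => f i x - g i x)
| expressible_add m m' f g : expressible S m f -> expressible S m' g ->
    expressible S (m + m').+1 (fun i x => f i x + g i x)
| expressible_mul m m' f g : expressible S m f -> expressible S m' g ->
    expressible S (m + m').+1 (fun i x => f i x * g i x)
| expressible_div m m' f g : expressible S m f -> expressible S m' g ->
    (forall i x, g i x != 0) ->
    expressible S (m + m').+1 (fun i x => f i x / g i x)
| expressible_le m m' f g : expressible S m f -> expressible S m' g ->
    expressible S (m + m').+1 (fun i x => (f i x <= g i x)%R%:R)
| expressible_sqrt m f : expressible S m f -> (forall i x, 0 <= f i x) ->
    expressible S m.+1 (fun i x => Num.sqrt (f i x))
| expressible_exp m f : expressible S m f ->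
    expressible S m.+1 (fun i x => expR (f i x)).

(** Lets the cost be found while the expression is decomposed and compared with the expected number
    afterwards. *)
Lemma expressible_cost (F : Type) S m m' (f : F -> T -> R) :
  expressible S m f -> m = m' -> expressible S m' f.
Proof. by move=> + <-. Qed.

Definition extends w s S w' s' (F : Type) (f : F -> T -> R) : Prop :=
  exists S', [/\ computable (w + w') (s + s') S', (forall g, S g -> S' g) &
    forall i, S' (f i)].

Lemma extends_layer (F : finType) w s S (f : F -> T -> R) :
  computable w s S -> (forall i, one_gate S (f i)) -> extends w s S #|F| 1 f.
Proof.
move=> C og; exists (S `|` range f); split.
- by rewrite addn1; exact: computable_layer.
- by move=> g; left.
- by move=> i; right; exists i.
Qed.

(** Quantifying over all larger [S'] allows the second operand of a gate to be built on top of the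
    circuit for the first. *)
Definition extendable (F : finType) S m (f : F -> T -> R) : Prop :=
  forall w s S', S `<=` S' -> computable w s S' -> extends w s S' (m * #|F|) m f.

Lemma extendable_gate1 (F : finType) S m (f h : F -> T -> R) :
  extendable S m f ->
  (forall S', (forall i, S' (f i)) -> forall i, one_gate S' (h i)) ->
  extendable S m.+1 h.
Proof.
move=> IHf og w s S' sub C.
have [S1 [C1 s1 f1]] := IHf _ _ _ sub C.
have [S2 [C2 s2 h2]] := extends_layer C1 (og _ f1).
exists S2; split=> // [|g /s1/s2//].
by apply: computableW C2 => //; lia.
Qed.

Lemma extendable_gate2 (F : finType) S m m' (f g h : F -> T -> R) :
  extendable S m f -> extendable S m' g ->
  (forall S', (forall i, S' (f i)) -> (forall i, S' (g i)) ->
     forall i, one_gate S' (h i)) ->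
  extendable S (m + m').+1 h.
Proof.
move=> IHf IHg og w s S' sub C.
have [S1 [C1 s1 f1]] := IHf _ _ _ sub C.
have [S2 [C2 s2 g2]] := IHg _ _ _ (subset_trans sub s1) C1.
have [S3 [C3 s3 h3]] := extends_layer C2 (og _ (fun i => s2 _ (f1 i)) g2).
exists S3; split=> // [|k /s1/s2/s3//].
by apply: computableW C3 => //; lia.
Qed.

Lemma extendable_expressible (F : finType) S m (f : F -> T -> R) :
  expressible S m f -> extendable S m f.
Proof.
elim=> {m f}.
- move=> f Sf w s S' sub C; exists S'; split=> // [|i]; last exact/sub.
  by rewrite mul0n !addn0.
- move=> h w s S' _ C; rewrite mul1n; apply: extends_layer => // i.
  exact: one_input.
- move=> a w s S' _ C; rewrite mul1n; apply: extends_layer => // i.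
  exact: one_const.
- move=> m m' f g _ IHf _ IHg; apply: extendable_gate2 IHf IHg _ => S' hf hg i.
  exact: one_sub.
- move=> m m' f g _ IHf _ IHg; apply: extendable_gate2 IHf IHg _ => S' hf hg i.
  exact: one_add.
- move=> m m' f g _ IHf _ IHg; apply: extendable_gate2 IHf IHg _ => S' hf hg i.
  exact: one_mul.
- move=> m m' f g _ IHf _ IHg g0; apply: extendable_gate2 IHf IHg _ => S' hf hg i.
  by apply: one_div.
- move=> m m' f g _ IHf _ IHg; apply: extendable_gate2 IHf IHg _ => S' hf hg i.
  exact: one_le.
- move=> m f _ IHf f0; apply: extendable_gate1 IHf _ => S' hf i.
  by apply: one_sqrt.
- move=> m f _ IHf; apply: extendable_gate1 IHf _ => S' hf i.
  exact: one_exp.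
Qed.

Definition gate_cost (op : R -> R -> R) c : Prop :=
  forall (F : Type) S (f g : F -> T -> R), (forall i, S (f i)) ->
    (forall i, S (g i)) -> expressible S c (fun i x => op (f i x) (g i x)).

Lemma gate_cost_add : gate_cost +%R 1.
Proof.
move=> F S f g hf hg.
by apply: (@expressible_add _ _ 0 0); exact: expressible_in.
Qed.

Lemma gate_cost_max : gate_cost Num.max 4.
Proof.
move=> F S f g hf hg.
(* The comparison bit selects the larger value: four gates in all. *)
have -> : (fun i x => Num.max (f i x) (g i x)) =
          (fun i x => g i x + (f i x - g i x) * (g i x <= f i x)%R%:R).
  apply/funext => i; apply/funext => x.
  by case: leP => _; rewrite ?mulr1 ?mulr0 ?addr0// addrC subrK.
apply: (@expressible_add _ _ 0 3); first exact: expressible_in.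
by apply: (@expressible_mul _ _ 1 1);
  [apply: (@expressible_sub _ _ 0 0) | apply: (@expressible_le _ _ 0 0)];
  exact: expressible_in.
Qed.

(** * Balanced evaluation trees *)

Section BalancedTree.
Context (op : R -> R -> R) (idx : R) (c : nat).
Hypothesis op_cost : gate_cost op c.
Hypothesis op_idx : op idx idx = idx.
Hypothesis op_cat : forall (J : Type) (r1 r2 : seq J) (a : J -> R),
  \big[op/idx]_(j <- r1 ++ r2) a j =
  op (\big[op/idx]_(j <- r1) a j) (\big[op/idx]_(j <- r2) a j).

(** Each list is halved and all halves are evaluated in parallel, as one family indexed by
    [F * bool]; the work at the levels forms a geometric series. [op_cat] replaces the monoid laws,
    because 0 is neutral for the maximum of nonnegative reals only. *)
Lemma extends_tree (J : Type) S k : forall (F : finType) w s S'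
    (r : F -> seq J) (a : F -> J -> T -> R),
  (forall i, size (r i) <= 2 ^ k)%N -> (forall i j, S (a i j)) ->
  S (fun=> idx) -> S `<=` S' -> computable w s S' ->
  extends w s S' (c * #|F| * (2 ^ k.+1 - 1)) (c * k.+1)
    (fun i x => \big[op/idx]_(j <- r i) a i j x).
Proof.
elim: k => [|k IH] F w s S' r a szr Sa Sidx sub C.
  (* One operation with [idx] treats empty and one-element lists alike, as a family of gates
     requires. *)
  pose b i := if r i is j :: _ then a i j else fun=> idx.
  have Sb i : S' (b i) by rewrite /b; case: (r i) => [|j ?]; exact: sub.
  have := op_cost Sb (fun=> sub _ Sidx).
  move=> /extendable_expressible/(_ w s S' (@subset_refl _ _) C) [S1 [C1 s1 h1]].
  exists S1; split=> //; first by apply: computableW C1 => //; lia.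
  move=> i; suff : (fun x => op (b i x) idx) =
      fun x => \big[op/idx]_(j <- r i) a i j x by move=> <-; exact: h1.
  apply/funext => x; rewrite /b; case: (r i) (szr i) => [|j [|//]] _.
    by rewrite big_nil.
  by rewrite big_cons big_nil.
pose r' (p : F * bool) := if p.2 then take (2 ^ k) (r p.1) else drop (2 ^ k) (r p.1).
have szr' p : (size (r' p) <= 2 ^ k)%N.
  have := szr p.1; rewrite /r' expnS.
  case: p.2; rewrite ?size_take ?size_drop; last by lia.
  by case: ifP; lia.
have [S1 [C1 s1 h1]] := IH (F * bool)%type w s S' r' (fun p => a p.1) szr'
   (fun p => Sa p.1) Sidx sub C.
have /extendable_expressible/(_ _ _ S1 (@subset_refl _ _) C1) :=
  op_cost (fun i => h1 (i, true)) (fun i => h1 (i, false)).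
move=> [S2 [C2 s2 h2]]; exists S2; split=> //.
- apply: computableW C2 => //; rewrite -?addnA leq_add2l.
    rewrite card_prod card_bool [(2 ^ k.+2)%N]expnS.
    have := expn_gt0 2 k.+1; set e := (2 ^ _)%N => /=; set F' := #|F| => e0.
    by rewrite mulnBr; nia.
  by rewrite [in leqRHS]mulnS addnC.
- by move=> g /s1/s2.
move=> i; rewrite (_ : (fun x => _) = fun x =>
  op (\big[op/idx]_(j <- r' (i, true)) a i j x)
     (\big[op/idx]_(j <- r' (i, false)) a i j x)); first exact: h2.
by apply/funext => x; rewrite /r'/= -op_cat cat_take_drop.
Qed.

End BalancedTree.

(** Labels lie between 1 and [s] and increase strictly along edges, so a path has at most [s]
    nodes. *)
Lemma computable_dag (O : Type) (out : O -> T -> R) w s S :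
  computable w s S -> (forall o, S (out o)) ->
  exists G : dag R I O, [/\ (dag_work G <= w)%N, (dag_span G <= s)%N &
    forall x, computes G (inp x) (fun o => out o x)].
Proof.
move=> [gs [val [dp [[szw dps ops vals] av]]]] Sout.
have top k : (k < size gs)%N ->
    all (fun a => (a < k)%N) (operands (gate_at gs k)).
  by move=> /ops; apply: sub_all => a /andP[].
have /choice[pos posP] : forall o, exists k,
    (k < size gs)%N /\ forall x, val x k = out o x.
  by move=> o; have [k] := av _ (Sout o); exists k.
pose G := Dag top (fun o => (posP o).1).
exists G; split => //; last first.
  by move=> x; exists (val x); split=> [k /vals|o]//; rewrite (posP o).2.
apply/bigmax_leqP => p; case: p => p _ /=.
have lab (a : 'I_(size gs)) q : path (fun a b : 'I_(size gs) => edge G a b) a q ->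
    (dp a + size q <= dp (last a q))%N.
  elim: q a => [|b q IH] a; first by rewrite addn0.
  move=> /= /andP[ab /IH]; have /andP[_ d] := allP (ops b (ltn_ord b)) _ ab.
  by rewrite addnS; lia.
case: p => //= a q /lab.
have /andP[a0 _] := dps a (ltn_ord a).
by have /andP[_] := dps (last a q) (ltn_ord _); lia.
Qed.

(** * Cost accounting in units of [N] work and [L] span *)

Section Units.
Context (N L : nat).
Hypothesis N_gt0 : (0 < N)%N.
Hypothesis L_gt0 : (0 < L)%N.
Hypothesis N_le : (N <= 2 ^ L)%N.

(* A unit of cost is [N] work and [L] span; it pays for a layer of [N] gates,
   and a constant number of units for a balanced tree with [N] leaves. *)
Definition affordable k S : Prop := computable (k * N) (k * L) S.

Lemma affordable0 : affordable 0 set0.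
Proof. exact: computable0. Qed.

Lemma affordableW k k' S : (k <= k')%N -> affordable k S -> affordable k' S.
Proof. by move=> kk; apply: computableW => //; rewrite leq_mul2r kk orbT. Qed.

Lemma affordable_expressible (F : finType) k S m (f : F -> T -> R) :
  (#|F| <= N)%N -> affordable k S -> expressible S m f ->
  exists S', [/\ affordable (k + m) S', (forall g, S g -> S' g) & forall i, S' (f i)].
Proof.
move=> FN C der.
have [S' [C' sub h]] := extendable_expressible der (@subset_refl _ _) C.
exists S'; split=> //; apply: computableW C' => //; rewrite mulnDl leq_add2l.
  by rewrite leq_mul2l FN orbT.
by rewrite leq_pmulr.
Qed.

(** One unit loads [idx]. The tree has depth [(up_log 2 #|J|).+1], at most [L.+1], and rounding the
    number of leaves up to a power of two keeps its work within [c * (4 * N)]. *)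
Lemma affordable_big (op : R -> R -> R) idx c (F J : finType) (P : pred J) k S m
    (a : F -> J -> T -> R) :
  gate_cost op c -> op idx idx = idx ->
  (forall (J' : Type) (r1 r2 : seq J') (a : J' -> R),
    \big[op/idx]_(j <- r1 ++ r2) a j =
    op (\big[op/idx]_(j <- r1) a j) (\big[op/idx]_(j <- r2) a j)) ->
  (#|F| <= N)%N -> (#|J| <= N)%N -> (#|F| * #|J| <= N)%N ->
  affordable k S -> expressible S m (fun (p : F * J) => a p.1 p.2) ->
  exists S', [/\ affordable (k + (m + 1 + 4 * c)) S', (forall g, S g -> S' g) &
    forall i, S' (fun x => \big[op/idx]_(j | P j) a i j x)].
Proof.
move=> cost opi opc FN JN FJN C der.
have [|S1 [C1 s1 h1]] := affordable_expressible _ C der; first by rewrite card_prod.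
have [|S2 [C2 s2 h2]] := @affordable_expressible unit _ _ _
  (fun _ _ => idx) _ C1 (expressible_const _ _).
  by rewrite card_unit.
have [r bigE _ [_ szP]] := big_enumP P.
have szr : (size r <= #|J|)%N by rewrite szP max_card.
have rk : (size r <= 2 ^ up_log 2 #|J|)%N by apply: leq_trans szr (up_logP _ _).
have [||||S3 [C3 s3 h3]] := @extends_tree op idx c cost opi opc J S2
  (up_log 2 #|J|) F _ _ S2 (fun=> r) a _ _ _ _ C2 => //.
- by move=> i j; exact/s2/(h1 (i, j)).
- exact: (h2 tt).
exists S3; split.
- apply: computableW C3 => //.
    suff : (#|F| * (2 ^ (up_log 2 #|J|).+1 - 1) <= 4 * N)%N.
      move=> /(leq_mul (leqnn c)); rewrite mulnA => h.
      have -> : ((k + (m + 1 + 4 * c)) * N = (k + m + 1) * N + c * (4 * N))%N by nia.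
      by rewrite leq_add2l.
    have [J0|J0] := posnP #|J|.
      by rewrite J0 up_log0 expn1 muln1 (leq_trans FN)// leq_pmull.
    have [J1|J1] := leqP #|J| 1.
      have -> : #|J| = 1%N by lia.
      by rewrite up_log1 expn1 muln1 (leq_trans FN)// leq_pmull.
    have := up_log_bounds (isT : (1 < 2)%N) J1 => /andP[lo _].
    have up0 : (0 < up_log 2 #|J|)%N by rewrite up_log_gt0.
    rewrite -(prednK up0) !expnS; move: lo; set e := (2 ^ _)%N; nia.
  have uL : (up_log 2 #|J| <= L)%N.
    by apply: up_log_min => //; exact: leq_trans N_le.
  nia.
- by move=> f /s1/s2/s3.
move=> i; rewrite (_ : (fun x => _) = fun x => \big[op/idx]_(j <- r) a i j x).
  exact: h3.
by apply/funext => x; rewrite bigE.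
Qed.

Lemma affordable_sum (F J : finType) (P : pred J) k S m (a : F -> J -> T -> R) :
  (#|F| <= N)%N -> (#|J| <= N)%N -> (#|F| * #|J| <= N)%N ->
  affordable k S -> expressible S m (fun (p : F * J) => a p.1 p.2) ->
  exists S', [/\ affordable (k + (m + 5)) S', (forall g, S g -> S' g) &
    forall i, S' (fun x => \sum_(j | P j) a i j x)].
Proof.
move=> FN JN FJN C der.
have := affordable_big P gate_cost_add _ _ FN JN FJN C der.
rewrite -addnA; apply; first by rewrite addr0.
by move=> J' r1 r2 b; rewrite big_cat.
Qed.

Lemma affordable_max (F J : finType) (P : pred J) k S m (a : F -> J -> T -> R) :
  (#|F| <= N)%N -> (#|J| <= N)%N -> (#|F| * #|J| <= N)%N ->
  affordable k S -> expressible S m (fun (p : F * J) => a p.1 p.2) ->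
  exists S', [/\ affordable (k + (m + 17)) S', (forall g, S g -> S' g) &
    forall i, S' (fun x => \big[Num.max/0]_(j | P j) a i j x)].
Proof.
move=> FN JN FJN C der.
have := affordable_big P gate_cost_max _ _ FN JN FJN C der.
rewrite -addnA; apply; first by rewrite maxxx.
(* For an empty first list, 0 is absorbed because a maximum with default value 0 is nonnegative. *)
move=> J' r1 r2 b; elim: r1 => [|j r1 IH]; last by rewrite /= !big_cons IH maxA.
by rewrite /= big_nil; symmetry; apply/max_r/bigmax_ge_id.
Qed.

End Units.

End Circuits.

(** * An oblivious run of the meta-algorithm *)


Section Guard.
Context {R : realType} {d : nat}.

(* The circuit must be defined on all inputs, including those on which the
   result of a division is discarded. *)
Definition guard (a : R) : R := a + (a <= 0)%R%:R.

Lemma guard_gt0 a : 0 <= a -> 0 < guard a.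
Proof.
rewrite /guard le_eqVlt => /orP[/eqP<-|a0]; first by rewrite lexx add0r.
by rewrite leNgt a0 addr0.
Qed.

Lemma guard_pos a : 0 < a -> guard a = a.
Proof. by move=> a0; rewrite /guard leNgt a0 addr0. Qed.

Definition normalize (u : 'rV[R]_d) : 'rV[R]_d := (guard (enorm u))^-1 *: u.

Lemma enorm_normalize u : enorm (normalize u) <= 1.
Proof.
have g0 := guard_gt0 (enorm_ge0 u).
rewrite /normalize enormZ gtr0_norm ?invr_gt0// mulrC ler_pdivrMr// mul1r.
by rewrite /guard lerDl.
Qed.

Lemma dotp_normalize u : dotp u (normalize u) = enorm u.
Proof.
have [->|u0] := eqVneq u 0; first by rewrite dotp0l enorm0.
rewrite /normalize guard_pos ?enorm_gt0// dotpZr -sqr_enorm expr2 mulKf//.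
by rewrite enorm_eq0.
Qed.

(** [normalize] sends the zero vector to zero instead of a basis vector; there the two eigenvalues
    agree, so the coefficient of the direction vanishes. *)
Lemma soc_exp_normalize (x : soc R d) : soc_exp x =
  (((expR (soc_eig1 x) - expR (soc_eig2 x)) / Num.sqrt 2) *: normalize x.1,
   (expR (soc_eig1 x) + expR (soc_eig2 x)) / Num.sqrt 2).
Proof.
rewrite soc_expE; congr pair; rewrite /normalize /soc_dir.
case: eqVneq => [x0|x0]; last by rewrite guard_pos// enorm_gt0.
by rewrite /soc_eig1 /soc_eig2 x0 enorm0 addr0 subr0 subrr mul0r !scale0r.
Qed.

End Guard.

Section Algorithm.
Context {R : realType} {n d : nat}.
Variables (v : 'I_n -> 'rV[R]_d) (gam : 'I_n -> R) (i1 : 'I_n).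
Local Notation D := (diam v gam i1).
Local Notation rk := (@jordan_rank R n).

Section FeasibilityTest.
(* [h] stands for eta / rho, and [us] for the sum of the first [t] centers. *)
Variables (alpha h : R).

Definition test_weight (t : nat) (us : 'rV[R]_d) (i : 'I_n) : soc R d :=
  soc_exp ((- h) *: ((us - t%:R *: v i, t%:R * (alpha - gam i)) : soc R d)).

Definition test_primal t us i : soc R d :=
  (prod_trace i1 (test_weight t us))^-1 *: test_weight t us i.

(** Closed form of the subproblem: a linear functional is maximized over the ball of radius
    [alpha - gam i1] around [v i1]. A zero functional yields the center of the ball. *)
Definition test_center t us : 'rV[R]_d :=
  v i1 + (alpha - gam i1)
    *: normalize (\sum_(i | i != i1) (test_primal t us i).1).

Definition test_accepts t us : bool :=
  (gam i1 <= alpha) &&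
  (0 <= sub_objective v gam i1 (test_primal t us) (test_center t us) alpha).

(** A rejection only clears the flag and does not stop the loop, so that the number of iterations is
    the same on all inputs. *)
Fixpoint test_run t : 'rV[R]_d * bool :=
  if t is t'.+1 then
    let s := test_run t' in
    (s.1 + test_center t' s.1, s.2 && test_accepts t' s.1)
  else (0, true).

Definition test_centers (t : nat) : 'rV[R]_d :=
  test_center t.-1 (test_run t.-1).1.

Lemma test_run_sum t : (test_run t).1 = \sum_(1 <= s < t.+1) test_centers s.
Proof.
elim: t => [|t IH]; first by rewrite big_geq.
by rewrite big_nat_recr// -IH.
Qed.

Lemma test_run_accepts t :
  (test_run t).2 -> forall s, (s < t)%N -> test_accepts s (test_run s).1.
Proof.
elim: t => [//|t IH] /= /andP[/IH acc a] s.
by rewrite ltnS leq_eqVlt => /orP[/eqP->|/acc].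
Qed.

(** Finds the first rejecting iteration, at which the feasibility test would have stopped; what the
    run does later is discarded. *)
Lemma test_run_rejects t : ~~ (test_run t).2 ->
  exists2 s, (s < t)%N & ~~ test_accepts s (test_run s).1 /\
    (forall s', (s' < s)%N -> test_accepts s' (test_run s').1).
Proof.
elim: t => [//|t IH] /=; rewrite negb_and.
case: (boolP (test_run t).2) => /= [acc a|/IH[s st hs] _].
  by exists t => //; split=> //; exact: test_run_accepts.
by exists s => //; rewrite ltnW.
Qed.

Lemma test_center_optimal t us : gam i1 <= alpha ->
  sub_optimal v gam i1 alpha (test_primal t us) (test_center t us) alpha.
Proof.
rewrite -subr_ge0 => ag; rewrite /test_center.
set W := \sum_(i | _) _; split.
  split => //; rewrite addrC addKr enormZ ger0_norm//.
  by rewrite -[leRHS]mulr1 ler_wpM2l// enorm_normalize.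
move=> x' g' [g'a hx]; rewrite /sub_objective -/W !lerD2r.
have key : dotp W (x' - v i1) <= dotp W ((alpha - gam i1) *: normalize W).
  rewrite dotpZr dotp_normalize (le_trans (dotp_le _ _))// mulrC.
  by rewrite ler_wpM2r ?enorm_ge0// (le_trans hx)// lerD2r.
have gk : g' / Num.sqrt 2 <= alpha / Num.sqrt 2.
  by rewrite ler_wpM2r// invr_ge0 sqrtr_ge0.
by move: key; rewrite !dotpDr dotpNr lerBlDl => key; rewrite lerD.
Qed.

Lemma not_test_accepts_rejects t us : ~~ test_accepts t us ->
  sub_rejects v gam i1 alpha (test_primal t us).
Proof.
rewrite negb_and -!ltNge; case: (ltP alpha (gam i1)) => /= [ag _|ag neg].
  left => -[x [g [ga /(le_trans (enorm_ge0 _))]]].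
  by rewrite subr_ge0 leNgt (le_lt_trans ga ag).
by right; exists (test_center t us), alpha; split=> //; exact: test_center_optimal.
Qed.

End FeasibilityTest.

(** Iterations are counted from 0 in [test_run] and from 1 in the meta-algorithm, hence [t.+1]. *)
Lemma test_primalE alpha eps t :
  let h := step_size v gam i1 alpha eps / rho v gam i1 in
  test_primal alpha h t (test_run alpha h t).1 =
  primal v gam i1 alpha eps (test_centers alpha h) t.+1.
Proof.
move=> h; have wE : test_weight alpha h t (test_run alpha h t).1 =
    unnormalized v gam i1 alpha eps (test_centers alpha h) t.
  by apply/funext => i; rewrite unnormalizedE /test_weight test_run_sum.
apply/funext => i; rewrite /test_primal wE.
by rewrite (primalE v gam i1 alpha eps _ t.+1 i) succnK.
Qed.

Lemma test_run_correct alpha eps :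
  let T := iterations v gam i1 alpha eps in
  let h := step_size v gam i1 alpha eps / rho v gam i1 in
  let r := test_run alpha h T in
  if r.2 then test_outputs v gam i1 alpha eps (T%:R^-1 *: r.1) ((1 + eps) * alpha)
  else test_exceeds v gam i1 alpha eps.
Proof.
move=> T h r.
have cont s : test_accepts alpha h s (test_run alpha h s).1 ->
    continues v gam i1 alpha eps (test_centers alpha h) s.+1.
  move=> /andP[ga obj]; split; rewrite -test_primalE//.
  exact: test_center_optimal.
case: ifPn => [ok|].
  exists (test_centers alpha h); split; last by rewrite /average -test_run_sum.
  by move=> [//|t] /andP[_ tT]; apply: cont; exact: test_run_accepts ok _ tT.
move=> /test_run_rejects[s sT [rej acc]].
exists (test_centers alpha h), s.+1; rewrite sT; split=> //; split.
  by move=> [//|t] /andP[_ ts]; apply: cont; exact: acc.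
by rewrite -test_primalE//; exact: not_test_accepts_rejects.
Qed.

(* The iteration counts and step sizes of the search depend on its step only,
   because the tolerated error is a fixed multiple of the diameter. *)
Definition round_iterations (i : nat) : nat :=
  `|Num.ceil (1296 * (9 / 4) ^+ i * ln rk)|%N.

Definition round_step (i : nat) : R :=
  Num.sqrt (ln rk / (round_iterations i)%:R).

Definition width (i : nat) : R := guard D * (2^-1 * (2 / 3) ^+ i).

Definition round_guess i (l : R) : R := l + 3^-1 * width i.

Definition round_run i l :=
  test_run (round_guess i l) (round_step i / (3 * guard D / Num.sqrt 2))
    (round_iterations i).

(** The upper end of the interval is not stored: it is the lower end plus [width i] in either
    outcome of a round. *)
Fixpoint search (i : nat) : R * 'rV[R]_d :=
  if i is i'.+1 then
    let s := search i' in let r := round_run i' s.1 in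
    if r.2 then (s.1, (round_iterations i')%:R^-1 *: r.1)
    else (round_guess i' s.1, s.2)
  else (guard D / 2, v i1).

Definition search_state i : state :=
  let s := search i in State s.1 (s.1 + width i) s.2 (s.1 + width i).

Lemma search_lower_ge i : 0 < D -> D / 2 <= (search i).1.
Proof.
move=> D0; elim: i => [|i IH] /=; first by rewrite guard_pos.
case: ifP => _ //=; apply: (le_trans IH); rewrite lerDl.
by rewrite !mulr_ge0 ?exprn_ge0// ltW// guard_gt0// ltW.
Qed.

Lemma width_gt0 i : 0 <= D -> 0 < width i.
Proof. by move=> D0; rewrite mulr_gt0 ?mulr_gt0 ?exprn_gt0 ?guard_gt0//; lra. Qed.

Lemma search_stepP i : (2 <= n)%N -> 0 < D ->
  search_step v gam i1 (search_state i) (search_state i.+1).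
Proof.
move=> n2 D0; set l := (search i).1.
have l0 := search_lower_ge i D0; have w0 := width_gt0 i (ltW D0).
have gE : guess (search_state i) = round_guess i l.
  by rewrite /guess /= -/l addrAC subrr add0r.
have g0 : 0 < round_guess i l by rewrite /round_guess; move: l0; rewrite -/l; lra.
have tg : tolerance (search_state i) * round_guess i l = width i / 3.
  by rewrite -gE guess_tolerance ?gE//= addrAC subrr add0r.
(* The tolerated error [tolerance * guess] is a third of the width, that is [D / 6 * (2 / 3) ^+ i].
   Inserted into [36 * D ^+ 2 * ln rk] over its square, it gives the constant 1296 and the ratio
   9/4. *)
have iE : iterations v gam i1 (round_guess i l) (tolerance (search_state i)) =
          round_iterations i.
  rewrite /iterations /round_iterations; congr (`|Num.ceil _|%N).
  rewrite -exprMn tg /Rbound /rho /width guard_pos//.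
  have -> : (9 / 4 : R) ^+ i = ((2 / 3) ^+ i ^+ 2)^-1.
    by rewrite -exprM mulnC exprM -exprVn; congr (_ ^+ _); field.
  have q0 : (2 / 3 : R) ^+ i != 0 by rewrite gt_eqF// exprn_gt0//; lra.
  have -> : (3 * D / Num.sqrt 2) ^+ 2 = 9 * D ^+ 2 / 2.
    by rewrite expr_div_n sqr_sqrt2; congr (_ / _); ring.
  move: ((2 / 3) ^+ i) q0 => q q0; rewrite sqr_sqrt2; field.
  by rewrite q0 gt_eqF.
have sE : step_size v gam i1 (round_guess i l) (tolerance (search_state i)) =
          round_step i by rewrite /step_size iE.
have wS : width i.+1 = width i * (2 / 3) by rewrite /width exprSr !mulrA.
have := @test_run_correct (round_guess i l) (tolerance (search_state i)).
rewrite iE sE /rho -[X in 3 * X / _](guard_pos D0) -/(round_run i l).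
have SE : search i.+1 = let r := round_run i l in
    if r.2 then (l, (round_iterations i)%:R^-1 *: r.1)
    else (round_guess i l, (search i).2) by [].
rewrite /search_step gE /search_state SE.
case: (round_run i l) => us [] /= out; [right|left].
- exists ((round_iterations i)%:R^-1 *: us),
    ((1 + tolerance (search_state i)) * round_guess i l).
  split; first exact: out.
  by rewrite mulrDl mul1r tg wS /round_guess; congr State; field.
- by split; [exact: out | rewrite wS /round_guess; congr State; field].
Qed.

Definition search_rounds (eps : R) k : Prop :=
  (2 / 3) ^+ k <= eps /\ forall i, (i < k)%N -> eps < (2 / 3) ^+ i.

(** For diameter 0 the meta-algorithm returns the initial sphere without any round; the factor
    [1 - (D <= 0)%R%:R] makes this choice arithmetically. *)
Definition final_center k : 'rV[R]_d :=
  v i1 + (1 - (D <= 0)%R%:R) *: ((search k).2 - v i1).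

Definition final_radius k : R := (1 - (D <= 0)%R%:R) * ((search k).1 + width k).

Lemma meta_output_final eps k : (2 <= n)%N -> (forall i, 0 <= gam i) ->
  search_rounds eps k ->
  meta_output v gam i1 eps (final_center k) (final_radius k).
Proof.
move=> n2 gam0 [ke kl]; rewrite /final_center /final_radius.
have D0 := diam_ge0 v gam i1; have opt := diam_le_opt v i1 n2 gam0.
case: (leP D 0) => Dle.
  have D00 : D = 0 by apply/le_anti; rewrite Dle.
  rewrite subrr scale0r addr0 mul0r.
  exists (D / 2), 0%N, (fun=> init_state v gam i1); split=> //=.
  - by rewrite lexx.
  - by rewrite D00 mul0r subr0 mulr0.
rewrite subr0 scale1r mul1r addrC subrK.
have wE i : width i = D / 2 * (2 / 3) ^+ i by rewrite /width guard_pos// mulrA.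
exists (D / 2), k, search_state; split=> //.
- by rewrite lexx.
- rewrite /search_state /init_state wE /= guard_pos// expr0 mulr1.
  by congr State; field.
- move=> i ik; split; last exact: search_stepP.
  by rewrite /= addrAC subrr add0r wE mulrC ltr_pM2l ?divr_gt0//; exact: kl.
- by rewrite /= addrAC subrr add0r wE mulrC ler_pM2r ?divr_gt0.
Qed.

End Algorithm.

(** * The circuit of the oblivious run *)


Ltac find_available := solve [intros; cbv beta; eauto 50 with nocore].

(** The order of the cases matters: instance-independent terms become constants first, and division
    by such a term is multiplication by a constant, so that no condition on the divisor remains. *)
Ltac express_rec := cbv beta; lazymatch goal with
  | |- expressible _ _ _ (fun p _ => @?c p) => eapply (@expressible_const _ _ _ _ _ _ c)
  | |- expressible _ _ _ (fun p x => @?a p x - @?b p x) =>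
      eapply (@expressible_sub _ _ _ _ _ _ _ _ a b); [express_rec | express_rec]
  | |- expressible _ _ _ (fun p x => @?a p x + @?b p x) =>
      eapply (@expressible_add _ _ _ _ _ _ _ _ a b); [express_rec | express_rec]
  | |- expressible _ _ _ (fun p x => @?a p x * (@?b p)) =>
      eapply (@expressible_mul _ _ _ _ _ _ _ _ a (fun p _ => b p));
      [express_rec | express_rec]
  | |- expressible _ _ _ (fun p x => @?a p x / @?b p x) =>
      eapply (@expressible_div _ _ _ _ _ _ _ _ a b); [express_rec | express_rec | ]
  | |- expressible _ _ _ (fun p x => @?a p x * @?b p x) =>
      eapply (@expressible_mul _ _ _ _ _ _ _ _ a b); [express_rec | express_rec]
  | |- expressible _ _ _ (fun p x => @GRing.natmul _ _
        (nat_of_bool (@Order.le _ _ (@?a p x) (@?b p x)))) =>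
      eapply (@expressible_le _ _ _ _ _ _ _ _ a b); [express_rec | express_rec]
  | |- expressible _ _ _ (fun p x => Num.sqrt (@?a p x)) =>
      eapply (@expressible_sqrt _ _ _ _ _ _ _ a); [express_rec | ]
  | |- expressible _ _ _ (fun p x => expR (@?a p x)) =>
      eapply (@expressible_exp _ _ _ _ _ _ _ a); express_rec
  | |- _ => eapply expressible_in; find_available
  end.

Ltac express :=
  (eapply expressible_cost; [express_rec | ]); [ .. | reflexivity].

Section AlgorithmCircuit.
Context {R : realType} {n d L : nat}.
Variable i1 : 'I_n.
Hypothesis n_ge2 : (2 <= n)%N.
Hypothesis d_gt0 : (0 < d)%N.
Hypothesis L_gt0 : (0 < L)%N.
Hypothesis nd_le : (n * d <= 2 ^ L)%N.

(** All families are instances, including those with negative radii; every division and square root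
    must be defined on them as well. *)
Definition instance : Type := ('I_n -> 'rV[R]_d) * ('I_n -> R).
Definition instance_input (x : instance) := sphere_input x.1 x.2.

Local Notation has k S := (affordable instance_input (n * d) L k S).
Local Notation der_ := (expressible instance_input).
Implicit Types (S : set (instance -> R)) (k m : nat).

Lemma nd_gt0 : (0 < n * d)%N.
Proof. by rewrite muln_gt0 d_gt0 (leq_trans _ n_ge2). Qed.

Lemma n_le_nd : (n <= n * d)%N. Proof. by rewrite leq_pmulr. Qed.
Lemma d_le_nd : (d <= n * d)%N.
Proof. by rewrite leq_pmull// (leq_trans _ n_ge2). Qed.

Lemma has_scalar k S m (f : instance -> R) :
  has k S -> der_ S m (fun (_ : unit) x => f x) ->
  exists S', [/\ has (k + m) S', (forall g, S g -> S' g) & S' f].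
Proof.
move=> C D; have [|S' [C' s h]] := affordable_expressible L_gt0 _ C D.
  by rewrite card_unit nd_gt0.
by exists S'; split=> //; exact: (h tt).
Qed.

Lemma has_matrix (F : finType) k S m (f : F -> 'I_d -> instance -> R) :
  (#|F| * d <= n * d)%N -> has k S ->
  der_ S m (fun (p : F * 'I_d) x => f p.1 p.2 x) ->
  exists S', [/\ has (k + m) S', (forall g, S g -> S' g) &
    forall i j, S' (f i j)].
Proof.
move=> FN C D; have [|S' [C' s h]] := affordable_expressible L_gt0 _ C D.
  by rewrite card_prod card_ord.
by exists S'; split=> // i j; exact: (h (i, j)).
Qed.

Lemma has_dotp (F : finType) k S (u w : F -> instance -> 'rV[R]_d) :
  (#|F| * d <= n * d)%N -> has k S ->
  (forall i j, S (fun x => u i x 0 j)) -> (forall i j, S (fun x => w i x 0 j)) ->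
  exists S', [/\ has (k + 6) S', (forall g, S g -> S' g) &
    forall i, S' (fun x => dotp (u i x) (w i x))].
Proof.
move=> FN C hu hw.
have FN' : (#|F| <= n * d)%N by rewrite (leq_trans _ FN)// leq_pmulr.
have D : der_ S 1 (fun (p : F * 'I_d) x => u p.1 x 0 p.2 * w p.1 x 0 p.2).
  by express.
by apply: (affordable_sum nd_gt0 L_gt0 nd_le xpredT FN' _ _ C D);
  rewrite card_ord// d_le_nd.
Qed.

Lemma has_enorm (F : finType) k S (u : F -> instance -> 'rV[R]_d) :
  (#|F| * d <= n * d)%N -> has k S -> (forall i j, S (fun x => u i x 0 j)) ->
  exists S', [/\ has (k + 7) S', (forall g, S g -> S' g) &
    forall i, S' (fun x => enorm (u i x))].
Proof.
move=> FN C hu.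
have FN' : (#|F| <= n * d)%N by rewrite (leq_trans _ FN)// leq_pmulr.
have [S1 [C1 s1 h1]] := has_dotp FN C hu hu.
have D : der_ S1 1 (fun (i : F) x => Num.sqrt (dotp (u i x) (u i x))).
  by express => i x; exact: dotpp_ge0.
have [S2 [C2 s2 h2]] := affordable_expressible L_gt0 FN' C1 D.
exists S2; split=> [|g /s1/s2//|i]; first by rewrite -addnA in C2.
by under eq_fun do rewrite enormE; exact: h2.
Qed.

Lemma has_normalize (F : finType) k S (u : F -> instance -> 'rV[R]_d) :
  (#|F| * d <= n * d)%N -> has k S -> (forall i j, S (fun x => u i x 0 j)) ->
  exists S', [/\ has (k + 11) S', (forall g, S g -> S' g) &
    forall i j, S' (fun x => normalize (u i x) 0 j)].
Proof.
move=> FN C hu.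
have [S1 [C1 s1 h1]] := has_enorm FN C hu.
have [|S2 [C2 s2 h2]] := @has_matrix F _ _ 4 (fun i j x =>
    u i x 0 j / (enorm (u i x) + (enorm (u i x) <= 0)%R%:R)) FN C1.
  by express => i x; rewrite gt_eqF// guard_gt0// enorm_ge0.
exists S2; split=> [|g /s1/s2//|i j]; first by rewrite -addnA in C2.
by under eq_fun do rewrite mxE mulrC; exact: h2.
Qed.

Lemma has_soc_exp (F : finType) k S (u : F -> instance -> soc R d) :
  (#|F| * d <= n * d)%N -> has k S -> (forall i j, S (fun x => (u i x).1 0 j)) ->
  (forall i, S (fun x => (u i x).2)) ->
  exists S', [/\ has (k + 33) S', (forall g, S g -> S' g) &
    (forall i j, S' (fun x => (soc_exp (u i x)).1 0 j)) /\
    (forall i, S' (fun x => (soc_exp (u i x)).2))].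
Proof.
move=> FN C hu hu2.
have FN' : (#|F| <= n * d)%N by rewrite (leq_trans _ FN)// leq_pmulr.
have [S1 [C1 s1 h1]] := has_enorm FN C hu.
have [S2 [C2 s2 h2]] := has_normalize FN C1 (fun i j => s1 _ (hu i j)).
have [|S3 [C3 s3 h3]] := @affordable_expressible _ _ _ _ _ _ L_gt0 F _ _ 4
  (fun i x => expR ((Num.sqrt 2)^-1 * ((u i x).2 + enorm (u i x).1))) FN' C2.
  by express.
have [|S4 [C4 s4 h4]] := @affordable_expressible _ _ _ _ _ _ L_gt0 F _ _ 4
  (fun i x => expR ((Num.sqrt 2)^-1 * ((u i x).2 - enorm (u i x).1))) FN' C3.
  by express.
(* Abstracting over the functions already computed keeps [express] from
   decomposing them again. *)
have [e1 H1 E1] : exists2 e1 : F -> instance -> R, forall i, S4 (e1 i) &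
    forall i x, e1 i x = expR (soc_eig1 (u i x)).
  by exists (fun i x => expR (soc_eig1 (u i x))) => // i; exact/s4/h3.
have [e2 H2 E2] : exists2 e2 : F -> instance -> R, forall i, S4 (e2 i) &
    forall i x, e2 i x = expR (soc_eig2 (u i x)).
  by exists (fun i x => expR (soc_eig2 (u i x))) => // i; exact: h4.
have H3 i j : S4 (fun x => normalize (u i x).1 0 j) by exact/s4/s3/h2.
have [|S5 [C5 s5 h5]] := @has_matrix F _ _ 4 (fun i j x =>
  (e1 i x - e2 i x) * (Num.sqrt 2)^-1 *
  normalize (u i x).1 0 j) FN C4.
  by express.
have [|S6 [C6 s6 h6]] := @affordable_expressible _ _ _ _ _ _ L_gt0 F _ _ 3
  (fun i x => (e1 i x + e2 i x) * (Num.sqrt 2)^-1) FN' C5.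
  by express.
exists S6; split.
- by apply: affordableW C6 => //; lia.
- by move=> g /s1/s2/s3/s4/s5/s6.
split=> [i j|i].
  by under eq_fun do rewrite soc_exp_normalize mxE -E1 -E2; exact/s6/h5.
by under eq_fun do rewrite soc_exp_normalize -E1 -E2; exact: h6.
Qed.

Lemma card_unit_d : (#|{: unit}| * d <= n * d)%N.
Proof. by rewrite card_unit mul1n d_le_nd. Qed.

Lemma card_ord_d : (#|'I_n| * d <= n * d)%N.
Proof. by rewrite card_ord. Qed.

Lemma card_ord_nd : (#|'I_n| <= n * d)%N.
Proof. by rewrite card_ord n_le_nd. Qed.

Lemma has_vsum k S (u : 'I_n -> instance -> 'rV[R]_d) (P : pred 'I_n) :
  has k S -> (forall i j, S (fun x => u i x 0 j)) ->
  exists S', [/\ has (k + 5) S', (forall g, S g -> S' g) &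
    forall j, S' (fun x => (\sum_(i | P i) u i x) 0 j)].
Proof.
move=> C hu.
have D : der_ S 0 (fun (p : 'I_d * 'I_n) x => u p.2 x 0 p.1) by express.
have [|||S1 [C1 s1 h1]] := @affordable_sum _ _ _ _ _ _ nd_gt0 L_gt0 nd_le
  _ _ P _ _ _ (fun j i x => u i x 0 j) _ _ _ C D; rewrite ?card_ord.
- by rewrite d_le_nd.
- by rewrite n_le_nd.
- by rewrite mulnC.
exists S1; split=> // j.
by under eq_fun do rewrite summxE; exact: h1.
Qed.

Lemma has_ssum k S m (f : 'I_n -> instance -> R) (P : pred 'I_n) :
  has k S -> der_ S m (fun (p : unit * 'I_n) x => f p.2 x) ->
  exists S', [/\ has (k + (m + 5)) S', (forall g, S g -> S' g) &
    S' (fun x => \sum_(i | P i) f i x)].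
Proof.
move=> C D; have [|||S1 [C1 s1 h1]] := @affordable_sum _ _ _ _ _ _ nd_gt0 L_gt0
  nd_le unit _ P _ _ _ (fun _ i x => f i x) _ _ _ C D;
  rewrite ?card_unit ?mul1n ?card_ord ?nd_gt0 ?n_le_nd//.
by exists S1; split=> //; exact: (h1 tt).
Qed.

Lemma prod_trace_weight_neq0 (x : instance) (al h : R) t us :
  prod_trace i1 (test_weight x.1 x.2 al h t us) != 0.
Proof.
have [j jj] := exists_other i1 n_ge2; rewrite gt_eqF//.
apply: lt_le_trans (eig1_le_prod_trace
  (fun i => (- h) *: ((us - t%:R *: x.1 i, t%:R * (al - x.2 i)) : soc R d)) jj).
exact: expR_gt0.
Qed.

Section FeasibilityCircuit.
Variables (al h : instance -> R) (us : instance -> 'rV[R]_d).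
Implicit Types (P : 'I_n -> instance -> soc R d) (c : instance -> 'rV[R]_d).

Lemma has_test_primal k S t : has k S -> S al -> S h ->
  (forall j, S (fun x => us x 0 j)) ->
  (forall i j, S (fun x => x.1 i 0 j)) -> (forall i, S (fun x => x.2 i)) ->
  exists S', [/\ has (k + 54) S', (forall g, S g -> S' g) &
    (forall i j, S' (fun x =>
       (test_primal x.1 x.2 i1 (al x) (h x) t (us x) i).1 0 j)) /\
    (forall i, S' (fun x => (test_primal x.1 x.2 i1 (al x) (h x) t (us x) i).2))].
Proof.
move=> C hal hh hus hv hg.
have [|S1 [C1 s1 h1]] := @has_matrix _ _ _ 6 (fun i j x =>
  (0 - h x) * (us x 0 j - t%:R * x.1 i 0 j)) card_ord_d C; first by express.
have [|S2 [C2 s2 h2]] := @affordable_expressible _ _ _ _ _ _ L_gt0 _ _ _ 6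
  (fun i x => (0 - h x) * (t%:R * (al x - x.2 i))) card_ord_nd C1.
  by express.
have [||S3 [C3 s3 [h3 h3']]] := @has_soc_exp _ _ _ (fun i (x : instance) =>
  ((- h x) *: ((us x - t%:R *: x.1 i, t%:R * (al x - x.2 i)) : soc R d)))
  card_ord_d C2.
- move=> i j; rewrite (_ : (fun x => _) = (fun x =>
    (0 - h x) * (us x 0 j - t%:R * x.1 i 0 j))); first exact/s2/h1.
  by apply/funext => x; rewrite /= !mxE sub0r.
- move=> i; rewrite (_ : (fun x => _) = (fun x =>
    (0 - h x) * (t%:R * (al x - x.2 i)))); first exact: h2.
  by apply/funext => x; rewrite sub0r.
have [W h4 WE] : exists2 W : 'I_n -> instance -> soc R d,
    (forall i j, S3 (fun x => (W i x).1 0 j)) /\ (forall i, S3 (fun x => (W i x).2)) &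
    forall i x, W i x = test_weight x.1 x.2 (al x) (h x) t (us x) i.
  by exists (fun i x => test_weight x.1 x.2 (al x) (h x) t (us x) i).
case: h4 => h4 h4'.
have [|S5 [C5 s5 h5]] := @has_ssum _ _ 2 (fun i x => Num.sqrt 2 * (W i x).2)
  (fun i => i != i1) C3; first by express.
have [tr h6 trE] : exists2 tr : instance -> R, S5 tr &
    forall x, tr x = prod_trace i1 (test_weight x.1 x.2 (al x) (h x) t (us x)).
  by eexists; first exact: h5; move=> x; apply: eq_bigr => i _; rewrite WE.
have tr0 x : tr x != 0 by rewrite trE prod_trace_weight_neq0.
have [|S7 [C7 s7 h7]] := @has_matrix _ _ _ 1 (fun i j x =>
  (W i x).1 0 j / tr x) card_ord_d C5; first by express.
have [|S8 [C8 s8 h8]] := @affordable_expressible _ _ _ _ _ _ L_gt0 _ _ _ 1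
  (fun i x => (W i x).2 / tr x) card_ord_nd C7; first by express.
exists S8; split.
- by apply: affordableW C8 => //; lia.
- by move=> g /s1/s2/s3/s5/s7/s8.
split=> [i j|i].
  rewrite (_ : (fun x => _) = (fun x => (W i x).1 0 j / tr x)); first exact/s8/h7.
  by apply/funext => x; rewrite mxE mulrC trE WE.
rewrite (_ : (fun x => _) = (fun x => (W i x).2 / tr x)); first exact: h8.
by apply/funext => x; rewrite mulrC trE WE.
Qed.

Lemma has_test_center k S P : has k S -> S al ->
  (forall i j, S (fun x => (P i x).1 0 j)) ->
  (forall i j, S (fun x => x.1 i 0 j)) -> (forall i, S (fun x => x.2 i)) ->
  exists S', [/\ has (k + 19) S', (forall g, S g -> S' g) & forall j, S' (fun x =>
    (x.1 i1 + (al x - x.2 i1) *: normalize (\sum_(i | i != i1) (P i x).1)) 0 j)].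
Proof.
move=> C hal hP hv hg.
have [S1 [C1 s1 h1]] := @has_vsum _ _ (fun i x => (P i x).1) (fun i => i != i1) C hP.
have [|S2 [C2 s2 h2]] := @has_normalize unit _ _
  (fun _ x => \sum_(i | i != i1) (P i x).1) card_unit_d C1 _; first by [].
have [N hN NE] : exists2 N : instance -> 'rV[R]_d, (forall j, S2 (fun x => N x 0 j)) &
    forall x, N x = normalize (\sum_(i | i != i1) (P i x).1).
  by eexists; first exact: (h2 tt).
have [|S3 [C3 s3 h3]] := @has_matrix unit _ _ 3 (fun _ j x =>
   x.1 i1 0 j + (al x - x.2 i1) * N x 0 j) card_unit_d C2; first by express.
exists S3; split.
- by apply: affordableW C3 => //; lia.
- by move=> g /s1/s2/s3.
by move=> j; under eq_fun do rewrite 2!mxE -NE; exact: (h3 tt).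
Qed.

Lemma has_sub_objective k S P c : has k S -> S al ->
  (forall i j, S (fun x => (P i x).1 0 j)) -> (forall i, S (fun x => (P i x).2)) ->
  (forall j, S (fun x => c x 0 j)) ->
  (forall i j, S (fun x => x.1 i 0 j)) -> (forall i, S (fun x => x.2 i)) ->
  exists S', [/\ has (k + 33) S', (forall g, S g -> S' g) & S' (fun x =>
    sub_objective x.1 x.2 i1 (P^~ x) (c x) (al x))].
Proof.
move=> C hal hP hP2 hc hv hg.
have [S1 [C1 s1 h1]] := @has_vsum _ _ (fun i x => (P i x).1) (fun i => i != i1) C hP.
have [||S2 [C2 s2 h2]] := @has_dotp unit _ _
  (fun _ x => \sum_(i | i != i1) (P i x).1) (fun _ => c) card_unit_d C1.
- by [].
- by move=> _ j; exact: s1.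
have [||S3 [C3 s3 h3]] := @has_dotp _ _ _
  (fun i (x : instance) => x.1 i) (fun i x => (P i x).1) card_ord_d C2.
- by move=> i j; exact/s2/s1.
- by move=> i j; exact/s2/s1.
have [|S4 [C4 s4 h4]] := @has_ssum _ _ 0 (fun i x => dotp (x.1 i) (P i x).1)
  (fun i => i != i1) C3; first by express.
have [|S5 [C5 s5 h5]] := @has_ssum _ _ 1 (fun i (x : instance) => x.2 i * (P i x).2)
  (fun i => i != i1) C4; first by express.
have [A hA AE] : exists2 A : instance -> R, S5 A &
    forall x, A x = dotp (\sum_(i | i != i1) (P i x).1) (c x).
  by eexists; first exact/s5/s4/s3/(h2 tt).
have [B hB BE] : exists2 B : instance -> R, S5 B &
    forall x, B x = \sum_(i | i != i1) dotp (x.1 i) (P i x).1.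
  by eexists; first exact/s5/h4.
have [G hG GE] : exists2 G : instance -> R, S5 G &
    forall x, G x = \sum_(i | i != i1) x.2 i * (P i x).2.
  by eexists; first exact/h5.
have [|S6 [C6 s6 h6]] := @has_scalar _ _ 5
  (fun x => A x + al x * (Num.sqrt 2)^-1 - B x - G x) C5; first by express.
exists S6; split.
- by apply: affordableW C6 => //; lia.
- by move=> g /s1/s2/s3/s4/s5/s6.
by under eq_fun do rewrite /sub_objective -AE -BE -GE; exact: h6.
Qed.

(** An iteration costs a constant number of units: 54 for the primal point, 19 for the center, 33
    for the objective, 5 for the flag and 1 for the sum of the centers. *)
Lemma has_test_step k S t (ok : instance -> bool) : has k S -> S al -> S h ->
  (forall j, S (fun x => us x 0 j)) -> S (fun x => (ok x)%:R) ->
  (forall i j, S (fun x => x.1 i 0 j)) -> (forall i, S (fun x => x.2 i)) ->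
  exists S', [/\ has (k + 112) S', (forall g, S g -> S' g) &
    (forall j, S' (fun x =>
       (us x + test_center x.1 x.2 i1 (al x) (h x) t (us x)) 0 j)) /\
    S' (fun x => (ok x && test_accepts x.1 x.2 i1 (al x) (h x) t (us x))%:R)].
Proof.
move=> C hal hh hus hok hv hg.
have [S1 [C1 s1 [h1 h1']]] := has_test_primal t C hal hh hus hv hg.
have [P [hP hP'] PE] : exists2 P : 'I_n -> instance -> soc R d,
    (forall i j, S1 (fun x => (P i x).1 0 j)) /\ (forall i, S1 (fun x => (P i x).2)) &
    forall x, test_primal x.1 x.2 i1 (al x) (h x) t (us x) = P^~ x.
  by exists (fun i x => test_primal x.1 x.2 i1 (al x) (h x) t (us x) i).
have inV : forall i j, S1 (fun x => x.1 i 0 j) by move=> i j; exact: s1.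
have inG : forall i, S1 (fun x => x.2 i) by move=> i; exact: s1.
have [S2 [C2 s2 h2]] := has_test_center C1 (s1 _ hal) hP inV inG.
have [c hc cE] : exists2 c : instance -> 'rV[R]_d,
    (forall j, S2 (fun x => c x 0 j)) &
    forall x, c x = test_center x.1 x.2 i1 (al x) (h x) t (us x).
  by eexists; [exact: h2 | move=> x; rewrite /test_center PE].
have [S3 [C3 s3 h3]] := has_sub_objective C2 (s2 _ (s1 _ hal))
  (fun i j => s2 _ (hP i j)) (fun i => s2 _ (hP' i)) hc
  (fun i j => s2 _ (inV i j)) (fun i => s2 _ (inG i)).
have [ob hob obE] : exists2 ob : instance -> R, S3 ob &
    forall x, ob x = sub_objective x.1 x.2 i1 (P^~ x) (c x) (al x).
  by eexists; first exact: h3.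
have [b hb bE] : exists2 b : instance -> R, S3 b & forall x, b x = (ok x)%:R.
  by eexists; first exact/s3/s2/s1/hok.
have [|S4 [C4 s4 h4]] := @has_scalar _ _ 5 (fun x =>
  b x * ((x.2 i1 <= al x)%R%:R * (0 <= ob x)%R%:R)) C3; first by express.
have [|S5 [C5 s5 h5]] := @has_matrix unit _ _ 1 (fun _ j x =>
  us x 0 j + c x 0 j) card_unit_d C4; first by express.
exists S5; split.
- by apply: affordableW C5 => //; lia.
- by move=> g /s1/s2/s3/s4/s5.
split=> [j|].
  by under eq_fun do rewrite mxE -cE; exact: (h5 tt).
rewrite (_ : (fun x => _) =
  (fun x => b x * ((x.2 i1 <= al x)%R%:R * (0 <= ob x)%R%:R))); first exact: s5.
by apply/funext => x; rewrite bE obE /test_accepts PE -cE -!natrM !mulnb.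
Qed.

End FeasibilityCircuit.

Lemma has_test_run (al h : instance -> R) k S t : has k S -> S al -> S h ->
  (forall i j, S (fun x => x.1 i 0 j)) -> (forall i, S (fun x => x.2 i)) ->
  exists S', [/\ has (k + (2 + 112 * t)) S', (forall g, S g -> S' g) &
    (forall j, S' (fun x => (test_run x.1 x.2 i1 (al x) (h x) t).1 0 j)) /\
    S' (fun x => (test_run x.1 x.2 i1 (al x) (h x) t).2%:R)].
Proof.
move=> C hal hh hv hg; elim: t => [|t [S1 [C1 s1 [h1 h1']]]].
  have [|S1 [C1 s1 h1]] := @has_scalar _ _ 1 (fun=> 0) C; first by express.
  have [|S2 [C2 s2 h2]] := @has_scalar _ _ 1 (fun=> 1) C1; first by express.
  exists S2; split.
  - by apply: affordableW C2 => //; lia.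
  - by move=> g /s1/s2.
  by split=> // j; under eq_fun do rewrite mxE; exact: s2.
have [S2 [C2 s2 h2]] := has_test_step t C1 (s1 _ hal) (s1 _ hh) h1 h1'
  (fun i j => s1 _ (hv i j)) (fun i => s1 _ (hg i)).
exists S2; split=> [|g /s1/s2//|//].
by apply: affordableW C2 => //; lia.
Qed.

Definition inputs_available S : Prop :=
  [/\ forall i j, S (fun x => x.1 i 0 j), forall i, S (fun x => x.2 i),
      S (fun x => diam x.1 x.2 i1) & S (fun x => guard (diam x.1 x.2 i1))].

Lemma inputs_availableS S S' : (forall g, S g -> S' g) ->
  inputs_available S -> inputs_available S'.
Proof.
move=> s [h1 h2 h3 h4]; split=> [i j|i||]; exact: s.
Qed.

Lemma has_inputs : exists S, has 34 S /\ inputs_available S.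
Proof.
have [|S1 [C1 s1 h1]] := @has_matrix _ _ _ 1
  (fun i j x => instance_input x (inl (i, j))) card_ord_d (affordable0 _ _ _).
  exact: (expressible_input _ _ (fun p : 'I_n * 'I_d => inl (p.1, p.2))).
have [|S2 [C2 s2 h2]] := @affordable_expressible _ _ _ _ _ _ L_gt0 _ _ _ 1
  (fun i x => instance_input x (inr i)) card_ord_nd C1.
  exact: expressible_input.
have hv i j : S2 (fun x => x.1 i 0 j) by exact/s2/h1.
have hg i : S2 (fun x => x.2 i) by exact: h2.
have [|S3 [C3 s3 h3]] := @has_matrix _ _ _ 1 (fun i j (x : instance) =>
  x.1 i1 0 j - x.1 i 0 j) card_ord_d C2; first by express.
have [|S4 [C4 s4 h4]] := @has_enorm _ _ _
  (fun i (x : instance) => x.1 i1 - x.1 i) card_ord_d C3.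
  by move=> i j; under eq_fun do rewrite !mxE; exact: h3.
have [||||S5 [C5 s5 h5]] := @affordable_max _ _ _ _ _ _ nd_gt0 L_gt0 nd_le unit
  _ (fun i => i != i1) _ _ 2
  (fun _ i (x : instance) => enorm (x.1 i1 - x.1 i) + x.2 i1 + x.2 i) _ _ _ C4.
- by rewrite card_unit nd_gt0.
- by rewrite card_ord n_le_nd.
- by rewrite card_unit mul1n card_ord n_le_nd.
- by express.
have [D hD DE] : exists2 D : instance -> R, S5 D & forall x, D x = diam x.1 x.2 i1.
  by eexists; first exact: (h5 tt).
have [|S6 [C6 s6 h6]] := @has_scalar _ _ 3
  (fun x => D x + (D x <= 0)%R%:R) C5; first by express.
exists S6; split; first by apply: affordableW C6.
split=> [i j|i||].
- exact/s6/s5/s4/s3.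
- exact/s6/s5/s4/s3.
- by under eq_fun do rewrite -DE; exact: s6.
- by under eq_fun do rewrite -DE; exact: h6.
Qed.

Lemma guard_diam_gt0 (x : instance) : 0 < guard (diam x.1 x.2 i1).
Proof. by rewrite guard_gt0// diam_ge0. Qed.

Definition search_cost (k : nat) : nat :=
  \sum_(i < k) (25 + 112 * @round_iterations R n i).

Lemma has_search k0 S k : has k0 S -> inputs_available S ->
  exists S', [/\ has (k0 + (2 + search_cost k)) S', (forall g, S g -> S' g) &
    S' (fun x => (search x.1 x.2 i1 k).1) /\
    (forall j, S' (fun x => (search x.1 x.2 i1 k).2 0 j))].
Proof.
move=> C hin; elim: k => [|k [S1 [C1 s1 [h1 h1']]]].
  have [G hG GE] : exists2 G : instance -> R, S G &
      forall x, G x = guard (diam x.1 x.2 i1).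
    by case: hin => _ _ _ hG; eexists; first exact: hG.
  have [|S1 [C1 s1 h1]] := @has_scalar _ _ 2 (fun x => G x * 2^-1) C.
    by express.
  exists S1; split=> //; first by rewrite /search_cost big_ord0.
  split; first by under eq_fun do rewrite /= -GE; exact: h1.
  by move=> j /=; case: hin => hv _ _ _; exact/s1.
have [hv hg _ hG'] := inputs_availableS s1 hin.
have [G hG GE] : exists2 G : instance -> R, S1 G &
    forall x, G x = guard (diam x.1 x.2 i1).
  by eexists; first exact: hG'.
have [l hl lE] : exists2 l : instance -> R, S1 l &
    forall x, l x = (search x.1 x.2 i1 k).1.
  by eexists; first exact: h1.
have [c hc cE] : exists2 c : instance -> 'rV[R]_d, (forall j, S1 (fun x => c x 0 j)) &
    forall x, c x = (search x.1 x.2 i1 k).2.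
  by eexists; first exact: h1'.
have [|S2 [C2 s2 h2]] := @has_scalar _ _ 5 (fun x =>
  l x + 3^-1 * (G x * (2^-1 * (2 / 3) ^+ k))) C1; first by express.
have [al hal alE] : exists2 al : instance -> R, S2 al &
    forall x, al x = round_guess x.1 x.2 i1 k (l x).
  by eexists; [exact: h2 | move=> x; rewrite /round_guess /width GE].
have [|S3 [C3 s3 h3]] := @has_scalar _ _ 6 (fun x =>
  @round_step R n k / (3 * G x * (Num.sqrt 2)^-1)) C2.
  express => _ x; rewrite gt_eqF// mulr_gt0 ?invr_gt0 ?sqrt2_gt0//.
  by rewrite mulr_gt0// GE guard_diam_gt0.
have [hh hhh hhE] : exists2 hh : instance -> R, S3 hh & forall x, hh x =
    @round_step R n k / (3 * guard (diam x.1 x.2 i1) / Num.sqrt 2).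
  by eexists; [exact: h3 | move=> x; rewrite -GE].
have [S4 [C4 s4 [h4 h4']]] := has_test_run (@round_iterations R n k) C3
  (s3 _ hal) hhh (fun i j => s3 _ (s2 _ (hv i j))) (fun i => s3 _ (s2 _ (hg i))).
have [us hus usE] : exists2 us : instance -> 'rV[R]_d,
    (forall j, S4 (fun x => us x 0 j)) &
    forall x, us x = (round_run x.1 x.2 i1 k (l x)).1.
  by eexists; [exact: h4 | move=> x; rewrite /round_run -alE -hhE].
have [ok hok okE] : exists2 ok : instance -> R, S4 ok &
    forall x, ok x = (round_run x.1 x.2 i1 k (l x)).2%:R.
  by eexists; [exact: h4' | move=> x; rewrite /round_run -alE -hhE].
(* The flag [ok], which is 0 or 1, selects between the old lower end and the guess; the center is
   selected in the same way. *)
have [|S5 [C5 s5 h5]] := @has_scalar _ _ 3 (fun x =>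
  al x + ok x * (l x - al x)) C4; first by express.
have [|S6 [C6 s6 h6]] := @has_matrix unit _ _ 5 (fun _ j x => c x 0 j +
    ok x * ((@round_iterations R n k)%:R^-1 * us x 0 j - c x 0 j)) card_unit_d C5.
  by express.
exists S6; split.
- by apply: affordableW C6 => //; rewrite /search_cost big_ord_recr/=; lia.
- by move=> g /s1/s2/s3/s4/s5/s6.
split=> [|j].
  rewrite (_ : (fun x => _) = (fun x => al x + ok x * (l x - al x))).
    exact: s6.
  apply/funext => x; rewrite okE /= -lE; case: (round_run _ _ _ _ _).2.
    by rewrite mul1r addrC subrK.
  by rewrite mul0r addr0 alE.
rewrite (_ : (fun x => _) = (fun x => c x 0 j +
    ok x * ((@round_iterations R n k)%:R^-1 * us x 0 j - c x 0 j))).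
  exact: (h6 tt).
apply/funext => x; rewrite okE usE /= -lE; case: (round_run _ _ _ _ _).2 => /=.
  by rewrite mul1r addrC subrK mxE.
by rewrite mul0r addr0 cE.
Qed.

Lemma algorithm_dag k :
  exists G : dag R ('I_n * 'I_d + 'I_n) (option 'I_d),
    [/\ (dag_work G <= (51 + search_cost k) * (n * d))%N,
        (dag_span G <= (51 + search_cost k) * L)%N &
        forall v gam, computes G (sphere_input v gam)
          (sphere_output (final_center v gam i1 k) (final_radius v gam i1 k))].
Proof.
have [S [C hin]] := has_inputs.
have [S1 [C1 s1 [h1 h1']]] := has_search k C hin.
have [hv _ hD' hG'] := inputs_availableS s1 hin.
have [D hD DE] : exists2 D : instance -> R, S1 D & forall x, D x = diam x.1 x.2 i1.
  by eexists; first exact: hD'.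
have [G hG GE] : exists2 G : instance -> R, S1 G &
    forall x, G x = guard (diam x.1 x.2 i1).
  by eexists; first exact: hG'.
have [l hl lE] : exists2 l : instance -> R, S1 l &
    forall x, l x = (search x.1 x.2 i1 k).1.
  by eexists; first exact: h1.
have [c hc cE] : exists2 c : instance -> 'rV[R]_d, (forall j, S1 (fun x => c x 0 j)) &
    forall x, c x = (search x.1 x.2 i1 k).2.
  by eexists; first exact: h1'.
have [|S2 [C2 s2 h2]] := @has_matrix unit _ _ 7 (fun _ j x => x.1 i1 0 j +
    (1 - (D x <= 0)%R%:R) * (c x 0 j - x.1 i1 0 j)) card_unit_d C1.
  by express.
have [|S3 [C3 s3 h3]] := @has_scalar _ _ 8 (fun x =>
    (1 - (D x <= 0)%R%:R) * (l x + G x * (2^-1 * (2 / 3) ^+ k))) C2.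
  by express.
pose out o (x : instance) :=
  sphere_output (final_center x.1 x.2 i1 k) (final_radius x.1 x.2 i1 k) o.
have Sout o : S3 (out o).
  case: o => [j|].
    rewrite (_ : out _ = (fun x => x.1 i1 0 j +
      (1 - (D x <= 0)%R%:R) * (c x 0 j - x.1 i1 0 j))); first exact: s3 _ (h2 tt j).
    by apply/funext => x; rewrite /out /= /final_center -DE -cE !mxE.
  rewrite (_ : out _ = (fun x =>
    (1 - (D x <= 0)%R%:R) * (l x + G x * (2^-1 * (2 / 3) ^+ k)))); first exact: h3.
  by apply/funext => x; rewrite /out /= /final_radius /width -GE -DE -lE.
have [dg [w s comp]] := computable_dag C3 Sout.
have e : (34 + (2 + search_cost k) + 7 + 8 = 51 + search_cost k)%N by lia.
exists dg; rewrite -e; split=> // v gam; exact: (comp (v, gam)).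
Qed.

End AlgorithmCircuit.

(** * Cost *)


Section Cost.
Context {R : realType}.
Implicit Types (eps : R) (n k i : nat).

Lemma search_rounds_exist eps : 0 < eps -> exists k, search_rounds eps k.
Proof.
move=> e0.
(* Bernoulli's inequality shows that some power of 2/3 falls below [eps]; the least such exponent is
   the number of rounds. *)
have bern k : 1 + k%:R / 2 <= (3 / 2 : R) ^+ k.
  elim: k => [|k IH]; first by rewrite expr0; lra.
  rewrite exprS -natr1; have : 0 <= k%:R :> R by []; nra.
have [k kP] : exists k, (2 / 3) ^+ k <= eps.
  exists (Num.bound (2 / eps)); set k := Num.bound _.
  have kb : 2 / eps < k%:R by apply: archi_boundP; rewrite divr_ge0// ltW.
  have -> : (2 / 3 : R) = (3 / 2)^-1 by rewrite invf_div.
  have p0 : 0 < (3 / 2 : R) ^+ k by rewrite exprn_gt0.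
  rewrite exprVn invf_ple ?posrE//.
  have -> : eps^-1 = 2 / eps / 2 by rewrite mulrAC divff ?mul1r.
  have := bern k; lra.
have ex : exists k, (2 / 3) ^+ k <= eps by exists k.
exists (ex_minn ex); case: ex_minnP => m mP mmin; split=> // i im.
by rewrite ltNge; apply: contraL im => /mmin; rewrite leqNgt.
Qed.

Lemma geometric_sum_le k : \sum_(i < k.+1) (9 / 4 : R) ^+ i <= 2 * (9 / 4) ^+ k.
Proof.
elim: k => [|k IH]; first by rewrite big_ord1 !expr0; lra.
rewrite big_ord_recr /=; apply: (le_trans (lerD IH (lexx _))).
have : 0 <= (9 / 4 : R) ^+ k by rewrite exprn_ge0.
by rewrite exprS; lra.
Qed.

(** The last round dominates the series, and [eps < (2 / 3) ^+ k.-1] holds in it since the search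
    had not stopped before. This avoids a factor for the number of rounds. *)
Lemma search_rounds_sum eps k : 0 < eps -> search_rounds eps k ->
  \sum_(i < k) (9 / 4 : R) ^+ i <= 2 / eps ^+ 2.
Proof.
move=> e0 [_]; case: k => [_|k /(_ k (leqnn _)) ek].
  by rewrite big_ord0 divr_ge0// exprn_ge0// ltW.
apply: (le_trans (geometric_sum_le k)); rewrite ler_pM2l//.
have -> : (9 / 4 : R) ^+ k = ((2 / 3) ^+ k ^+ 2)^-1.
  by rewrite -exprM mulnC exprM -exprVn; congr (_ ^+ _); field.
have p0 : 0 < (2 / 3 : R) ^+ k by rewrite exprn_gt0.
rewrite lef_pV2 ?posrE ?exprn_gt0//.
by rewrite ler_sqr ?nnegrE ltW.
Qed.

(** Because [2 * n.-1] is at most the square of [n]. *)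
Lemma ln_rank_le n : (2 <= n)%N -> ln (@jordan_rank R n) <= 2 * ln n%:R.
Proof.
move=> n2; rewrite mulr_natl -lnXn ?ltr0n ?(leq_trans _ n2)// -natrX.
rewrite ler_ln ?posrE ?ltr0n ?expn_gt0 ?(leq_trans _ n2)//.
  by rewrite ler_nat; nia.
by rewrite muln_gt0; case: n n2 => [|[|]].
Qed.

Lemma round_iterations_le n i : (2 <= n)%N ->
  (@round_iterations R n i)%:R <= 2592 * (9 / 4) ^+ i * ln n%:R + 1 :> R.
Proof.
move=> n2; have q0 : 0 <= (9 / 4 : R) ^+ i by rewrite exprn_ge0.
have l0 : 0 <= ln (@jordan_rank R n) by apply/ltW/ln_rank_gt0.
have y0 : 0 <= 1296 * (9 / 4) ^+ i * ln (@jordan_rank R n).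
  exact: mulr_ge0 (mulr_ge0 (ler0n _ _) q0) l0.
have -> : (@round_iterations R n i)%:R =
    (Num.ceil (1296 * (9 / 4) ^+ i * ln (@jordan_rank R n)))%:~R :> R.
  rewrite -[LHS]mulrz_nat natz gez0_abs// ceil_ge0.
  by apply: lt_le_trans y0.
have := ceilB1_lt (1296 * (9 / 4) ^+ i * ln (@jordan_rank R n)).
rewrite intrD rmorphN1 ltrBlDr => /ltW /le_trans; apply.
rewrite lerD2r; have := ln_rank_le n2.
have -> : 2592 * (9 / 4) ^+ i * ln n%:R = 1296 * (9 / 4) ^+ i * (2 * ln n%:R) :> R.
  by ring.
by move=> h; apply: ler_wpM2l h; exact: mulr_ge0 (ler0n _ _) q0.
Qed.

(** Here 325 is 51 + 2 * 137, where 137 is 25 + 112 with the rounding of the iteration count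
    included; dividing by [ln 2] turns these constants into multiples of [ln n%:R]. *)
Definition cost_bound : R := 325 / ln 2 + 2 * (112 * 2592).

Lemma ln2_gt0 : 0 < ln 2 :> R.
Proof. by apply: ln_gt0; lra. Qed.

Lemma cost_bound_gt0 : 0 < cost_bound.
Proof.
apply: addr_gt0; first exact: divr_gt0 (ltr0Sn _ _) ln2_gt0.
exact: mulr_gt0 (ltr0Sn _ _) (mulr_gt0 (ltr0Sn _ _) (ltr0Sn _ _)).
Qed.

Lemma cost_le n eps k : (2 <= n)%N -> 0 < eps <= 1 -> search_rounds eps k ->
  (51 + @search_cost R n k)%:R <= cost_bound * (ln n%:R / eps ^+ 2).
Proof.
move=> n2 /andP[e0 e1] sr.
have l2 := ln2_gt0.
have ln2 : ln 2 <= ln n%:R :> R.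
  by rewrite ler_ln ?posrE ?ltr0n ?(leq_trans _ n2)// ler_nat.
have one : 1 <= ln n%:R / ln 2 :> R by rewrite ler_pdivlMr// mul1r.
have e2 : 1 <= (eps ^+ 2)^-1 :> R.
  by rewrite invf_ge1 ?exprn_gt0// expr_le1// ltW.
have ln0 : 0 <= ln n%:R :> R by rewrite (le_trans _ ln2)// ltW.
have step i : (25 + 112 * @round_iterations R n i)%:R <=
    (137 / ln 2 + 112 * 2592) * ln n%:R * (9 / 4) ^+ i :> R.
  have q1 : 1 <= (9 / 4 : R) ^+ i by rewrite exprn_ege1//; lra.
  have := round_iterations_le i n2; rewrite natrD natrM => h.
  have : 137 <= 137 * (ln n%:R / ln 2 * (9 / 4) ^+ i) :> R.
    by rewrite ler_peMr// mulr_ege1.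
  rewrite (_ : (137 / ln 2 + 112 * 2592) * ln n%:R * (9 / 4) ^+ i =
    137 * (ln n%:R / ln 2 * (9 / 4) ^+ i) +
    112 * (2592 * (9 / 4) ^+ i * ln n%:R) :> R); last by ring.
  by lra.
have sumb : (@search_cost R n k)%:R <=
    (137 / ln 2 + 112 * 2592) * ln n%:R * (2 / eps ^+ 2).
  rewrite natr_sum (le_trans (ler_sum _ (fun (i : 'I_k) _ => step i)))//.
  rewrite -mulr_sumr; apply: ler_wpM2l; last exact: search_rounds_sum.
  apply: mulr_ge0 ln0; apply: addr_ge0; last exact: mulr_ge0 (ler0n _ _) (ler0n _ _).
  exact: divr_ge0 (ler0n _ _) (ltW l2).
have h51 : 51 <= 51 * (ln n%:R / ln 2 * (eps ^+ 2)^-1).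
  by rewrite ler_peMr// mulr_ege1.
rewrite natrD (le_trans (lerD h51 sumb))// le_eqVlt; apply/orP; left; apply/eqP.
by rewrite /cost_bound; ring.
Qed.

(** For [2 <= m] the integer logarithm is at least 1, so adding one to it at most doubles it. *)
Lemma depth_unit m : (2 <= m)%N -> exists L, [/\ (0 < L)%N, (m <= 2 ^ L)%N &
  L%:R <= 2 / ln 2 * ln m%:R :> R].
Proof.
move=> m2; exists (trunc_log 2 m).+1; split=> //.
  by rewrite ltnW// trunc_log_ltn.
have l2 := ln2_gt0.
have m0 : (0 < m)%N by apply: leq_trans m2.
have t1 : (1 <= trunc_log 2 m)%N by rewrite trunc_log_gt0 m2.
have : (trunc_log 2 m)%:R * ln 2 <= ln m%:R :> R.
  rewrite mulr_natl -lnXn ?ltr0n// -natrX.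
  by rewrite ler_ln ?posrE ?ltr0n ?expn_gt0// ler_nat trunc_logP.
move=> h; rewrite -(ler_pM2r l2).
have -> : 2 / ln 2 * ln m%:R * ln 2 = 2 * ln m%:R :> R by field; rewrite gt_eqF.
apply: (@le_trans _ _ (2 * ((trunc_log 2 m)%:R * ln 2))).
  by rewrite mulrA ler_pM2r// -natrM ler_nat; lia.
by rewrite ler_pM2l.
Qed.

End Cost.

Theorem theorem5 (R : realType) :
  exists C : R, 0 < C /\
  forall (n d : nat) (hn : (2 <= n)%N) (hd : (1 <= d)%N)
         (eps : R) (heps : 0 < eps <= 1),
    (forall (v : 'I_n -> 'rV[R]_d) (gam : 'I_n -> R),
       (forall i, 0 <= gam i) ->
       forall (c : 'rV[R]_d) (g : R),
         meta_output v gam (Ordinal (ltnW hn)) eps c g ->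
         encloses v gam c g /\ g <= (1 + eps) * opt_radius v gam) /\
    (exists G : dag R ('I_n * 'I_d + 'I_n) (option 'I_d),
       [/\ (dag_work G)%:R <= C * ((n * d)%:R * ln n%:R / eps ^+ 2),
           (dag_span G)%:R <= C * (ln (n * d)%:R * ln n%:R / eps ^+ 2)
         & forall (v : 'I_n -> 'rV[R]_d) (gam : 'I_n -> R),
             (forall i, 0 <= gam i) ->
             exists (c : 'rV[R]_d) (g : R),
               computes G (sphere_input v gam) (sphere_output c g) /\
               meta_output v gam (Ordinal (ltnW hn)) eps c g]).
Proof.
have l2 := @ln2_gt0 R.
have cb := @cost_bound_gt0 R; move: (@cost_bound R) cb (@cost_le R) => K cb cost_le.
have s0 : 0 < 2 / ln 2 :> R by exact: divr_gt0.
(* The work needs the factor [K] and the span the factor [K * (2 / ln 2)]; their sum serves both. *)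
exists (K * (1 + 2 / ln 2)); split.
  by apply: mulr_gt0 => //; apply: addr_gt0.
move=> n d hn hd eps heps; have /andP[e0 e1] := heps; split.
  move=> v gam gam0 c g; apply: meta_output_sound => //.
  exact: ltW.
have [k sr] := search_rounds_exist e0.
have nd2 : (2 <= n * d)%N by rewrite (leq_trans hn)// leq_pmulr.
have [L [L0 ndL LE]] := depth_unit (R := R) nd2.
have [G [w s comp]] := algorithm_dag (R := R) (Ordinal (ltnW hn)) hn hd L0 ndL k.
have ce := cost_le n eps k hn heps sr.
have ln0 : 0 <= ln n%:R :> R by rewrite ln_ge0// ler1n ltnW.
have lnd0 : 0 <= ln (n * d)%:R :> R by rewrite ln_ge0// ler1n ltnW.
have ie : 0 <= (eps ^+ 2)^-1 by rewrite invr_ge0 exprn_ge0// ltW.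
exists G; split.
- rewrite -(ler_nat R) natrM in w; apply: (le_trans w).
  apply: (le_trans (ler_wpM2r (ler0n _ _) ce)).
  have -> : K * (ln n%:R / eps ^+ 2) * (n * d)%:R =
    K * 1 * ((n * d)%:R * ln n%:R / eps ^+ 2) by ring.
  apply: ler_wpM2r; first by apply: mulr_ge0 => //; apply: mulr_ge0.
  by apply: ler_wpM2l; [exact: ltW | rewrite lerDl ltW].
- rewrite -(ler_nat R) natrM in s; apply: (le_trans s).
  have ce0 : 0 <= K * (ln n%:R / eps ^+ 2).
    by apply: mulr_ge0; [exact: ltW | exact: mulr_ge0].
  apply: (le_trans (ler_pM (ler0n _ _) (ler0n _ _) ce LE)).
  have -> : K * (ln n%:R / eps ^+ 2) * (2 / ln 2 * ln (n * d)%:R) =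
    K * (2 / ln 2) * (ln (n * d)%:R * ln n%:R / eps ^+ 2) by ring.
  apply: ler_wpM2r; first by apply: mulr_ge0 => //; apply: mulr_ge0.
  by apply: ler_wpM2l; [exact: ltW | rewrite lerDr].
move=> v gam gam0.
exists (final_center v gam (Ordinal (ltnW hn)) k),
  (final_radius v gam (Ordinal (ltnW hn)) k); split; first exact: comp.
exact: meta_output_final.
Qed.
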